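(* For every $\epsilon>0$ and all Gaussian measures $\mu_0,\mu_1$ on $\mathcal H$, $S^\epsilon_{d^2}(\mu_0,\mu_1)\ge0$, and $S^\epsilon_{d^2}(\mu_0,\mu_1)=0$ if and only if $\mu_0=\mu_1$.
   Context: $\mathcal H$ real separable Hilbert space; Gaussian measures $\mathcal N(m,C)$ with $C$ positive trace class (possibly singular). $\mathrm{OT}^\epsilon_{d^2}(\mu,\nu)=\min_{\gamma\in\mathrm{Joint}(\mu,\nu)}\{\int\|x-y\|^2d\gamma+\epsilon\mathrm{KL}(\gamma\|\mu\otimes\nu)\}$; $S^\epsilon_{d^2}(\mu,\nu)=\mathrm{OT}^\epsilon_{d^2}(\mu,\nu)-\frac12(\mathrm{OT}^\epsilon_{d^2}(\mu,\mu)+\mathrm{OT}^\epsilon_{d^2}(\nu,\nu))$. *)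

(* Defs.v *)
From HB Require Import structures.
From mathcomp Require Import all_boot all_order all_algebra.
From mathcomp Require Import all_classical all_reals all_analysis.
Set Implicit Arguments. Unset Strict Implicit. Unset Printing Implicit Defensive.
Import Order.TTheory GRing.Theory Num.Theory.
Import numFieldNormedType.Exports.
Local Open Scope classical_set_scope.
Local Open Scope ring_scope.

Definition inner_product (R : realType) (H : completeNormedModType R)
    (ip : H -> H -> R) : Prop :=
  [/\ forall x y, ip x y = ip y x,
      forall a x y z, ip (a *: x + y) z = a * ip x z + ip y z &
      forall x, ip x x = `|x| ^+ 2].

Definition separable_space (T : topologicalType) : Prop :=
  exists D : set T, countable D /\ closure D = setT.

Definition hilbert_space (R : realType) (H : completeNormedModType R)
    (ip : H -> H -> R) : Prop :=
  inner_product ip /\ separable_space H.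

Definition borel (T : topologicalType) := g_sigma_algebraType (@open T).

Definition gauss1 (R : realType) (m s : R) : set R -> \bar R :=
  if s == 0 then \d_m else normal_prob m s.

(* Gaussian (Borel probability) measure on the Hilbert space: every
   one-dimensional projection x |-> <x, h> is (possibly degenerate) Gaussian.
   Equivalently: mu = N(m, C), C positive symmetric trace class. *)
Definition gaussian_measure (R : realType) (H : completeNormedModType R)
    (ip : H -> H -> R) (mu : probability (borel H) R) : Prop :=
  forall h : H, exists m s : R, 0 <= s /\
    forall A : set R, measurable A ->
      mu ((fun x : borel H => ip x h) @^-1` A) = gauss1 m s A.

Definition coupling (R : realType) d (T : measurableType d)
    (mu nu : probability T R) (g : probability (T * T)%type R) : Prop :=
  (forall A, measurable A -> g (fst @^-1` A) = mu A) /\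
  (forall A, measurable A -> g (snd @^-1` A) = nu A).

(* Kullback-Leibler divergence KL(g || rho) = int f ln f d rho where
   f = dg/drho, and +oo if g is not absolutely continuous w.r.t. rho
   (infimum over the empty set of densities). *)
Definition density_of (R : realType) d (T : measurableType d)
    (g rho : set T -> \bar R) (f : T -> R) : Prop :=
  [/\ measurable_fun setT f, forall x, 0 <= f x &
      forall A, measurable A -> g A = (\int[rho]_(x in A) (f x)%:E)%E].

Definition KL (R : realType) d (T : measurableType d)
    (g rho : set T -> \bar R) : \bar R :=
  ereal_inf [set (\int[rho]_x (f x * ln (f x))%:E)%E | f in density_of g rho].

Definition OTeps (R : realType) (H : completeNormedModType R) (eps : R)
    (mu nu : probability (borel H) R) : \bar R :=
  ereal_inf [set ((\int[g]_z (`|z.1 - z.2| ^+ 2)%:E)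
                  + eps%:E * KL g (mu \x nu))%E
            | g in @coupling R _ (borel H) mu nu].

Definition Seps (R : realType) (H : completeNormedModType R) (eps : R)
    (mu nu : probability (borel H) R) : \bar R :=
  (OTeps eps mu nu - (OTeps eps mu mu + OTeps eps nu nu) * (2^-1)%:E)%E.

(* Main.v *)
(* The argument works for all probability measures with finite second moment on a
   separable Hilbert space; Gaussian measures have one.  Let
   k(x, y) = exp(- |x - y|^2 / eps), a positive definite kernel, with reproducing
   kernel space V.  For a measure P, minimise |v|^2 / 2 - int ln v dP over positive
   v in V: minimising sequences are Cauchy by strict convexity, and the first order
   conditions at the limit h say that |h| = 1 and
     h(x) = int k(x, y) / h(y) dP(y).
   Hence k(x, y) / (h(x) h(y)) is the density of a coupling of P with itself, whose
   cost is - 2 eps int ln h dP.  Young's inequality p ln p >= p s - e^s + p, applied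
   with e^s = k(x, y) / (h0(x) h1(y)), bounds the cost of every coupling of mu0 and
   mu1 from below and gives
     S(mu0, mu1) >= eps (1 - <h0, h1>) = eps |h0 - h1|^2 / 2 >= 0.
   If S vanishes then h0 = h1 = h, so the measures mu_i / h have the same integral
   against every k(x, .), that is, the measures exp(- |y|^2 / eps) mu_i(dy) / h(y)
   have the same Laplace transform, and they coincide. *)
Require Import Defs.
From HB Require Import structures.
From mathcomp Require Import all_boot all_order all_algebra.
From mathcomp Require Import all_classical all_reals all_analysis.
From mathcomp Require Import measurable_realfun.
From mathcomp Require Import ring lra.
Set Implicit Arguments. Unset Strict Implicit. Unset Printing Implicit Defensive.
Import Order.TTheory GRing.Theory Num.Theory.
Import numFieldNormedType.Exports.
Local Open Scope classical_set_scope.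
Local Open Scope ring_scope.

(** * Real-valued integrals *)

(** The space V is never built: its elements occur as finite lists of weighted points or as
    pointwise limits of such lists, and [v(x) = <v, k(., x)>] with [k(x, x) = 1] turns norm
    estimates into pointwise ones. In terms of transport, [- eps ln h] is the dual (Sinkhorn)
    potential of the pair [(P, P)], and the Schroedinger equation says that the associated plan has
    the right marginals. The obstacle is that competitors must stay positive: perturbing a minimiser
    by [t k(., x)] with [t > 0] gives only [int k(x, y) / h(y) dP(y) <= h(x)]. The reverse
    inequality comes from a squared norm in which [t] may be negative. That norm involves an
    integral of kernel functions, so positivity of [k] has to pass from finite sums to integrals, by
    discretisation. A Gaussian measure is given only by its one-dimensional projections, so the
    finiteness of its second moment has to be proved as well. *)

Section real_integrals.
Context d (T : measurableType d) (R : realType).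
Variable mu : {measure set T -> \bar R}.
Implicit Types f g : T -> R.

Local Notation itg f := (mu.-integrable setT (EFin \o f)).

Lemma integrable_mfun f : itg f -> measurable_fun setT f.
Proof. by move=> /integrableP[/measurable_EFinP]. Qed.

Lemma itg_le f g : measurable_fun setT f -> itg g ->
  (forall x, `|f x| <= g x) -> itg f.
Proof.
move=> mf ig fg; apply: le_integrable ig => //; first exact/measurable_EFinP.
by move=> x _ /=; rewrite lee_fin (le_trans (fg x))// ler_norm.
Qed.

Lemma itgD f g : itg f -> itg g -> itg (fun x => f x + g x).
Proof. by move=> fi gi; exact: (integrableD measurableT fi gi). Qed.

Lemma itgZ (c : R) f : itg f -> itg (fun x => c * f x).
Proof. by move=> fi; exact: (integrableZl measurableT c fi). Qed.

Lemma itgN f : itg f -> itg (fun x => - f x).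
Proof. by move=> fi; apply: eq_integrable (itgZ (-1) fi) => // x _ /=; rewrite mulN1r. Qed.

Lemma itgB f g : itg f -> itg g -> itg (fun x => f x - g x).
Proof. by move=> fi gi; apply: itgD => //; exact: itgN. Qed.

Lemma RintN f : itg f -> \int[mu]_x (- f x) = - \int[mu]_x f x.
Proof.
move=> fi; rewrite -mulN1r -RintegralZl//.
by apply: eq_Rintegral => x _; rewrite mulN1r.
Qed.

Lemma itg_sum I (s : seq I) (F : I -> T -> R) :
  (forall i, itg (F i)) -> itg (fun x => \sum_(i <- s) F i x).
Proof.
move=> Fi; elim: s => [|i s IH].
  by apply: eq_integrable (integrable0 mu setT) => // x _ /=; rewrite big_nil.
apply: eq_integrable (itgD (Fi i) IH) => // x _ /=; rewrite big_cons//.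
Qed.

Lemma Rint_sum I (s : seq I) (F : I -> T -> R) : (forall i, itg (F i)) ->
  \int[mu]_x (\sum_(i <- s) F i x) = \sum_(i <- s) \int[mu]_x F i x.
Proof.
move=> Fi; elim: s => [|i s IH].
  rewrite big_nil; under eq_Rintegral do rewrite big_nil.
  by rewrite Rintegral_cst// mul0r.
rewrite big_cons -IH -RintegralD//; last exact: itg_sum.
by apply: eq_Rintegral => x _; rewrite big_cons.
Qed.

Lemma itg_between a b f : measurable_fun setT f -> itg a -> itg b ->
  (forall x, a x <= f x <= b x) -> itg f.
Proof.
move=> mf ia ib ab.
have := itgD (integrable_norm ia) (integrable_norm ib).
move/(itg_le mf); apply => x /=; rewrite ler_norml.
have /andP[h1 h2] := ab x.
have := ler_norm (b x); have := lerNnormlW (lexx `|a x|).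
by move: (normr_ge0 (a x)) (normr_ge0 (b x)) => ? ? ? ?; apply/andP; split; lra.
Qed.

Lemma EFin_Rint f : itg f -> (\int[mu]_x f x)%:E = (\int[mu]_x (f x)%:E)%E.
Proof. by move=> fi; rewrite /Rintegral fineK//; exact: integrable_fin_num. Qed.

Lemma ge0_itg_fin f (c : R) : measurable_fun setT f -> (forall x, 0 <= f x) ->
  (\int[mu]_x (f x)%:E <= c%:E)%E -> itg f /\ \int[mu]_x f x <= c.
Proof.
move=> mf f0 fc; have fi : itg f.
  apply/integrableP; split; first exact/measurable_EFinP.
  under eq_integral do rewrite /= ger0_norm//.
  by rewrite (le_lt_trans fc)// ltry.
by split => //; rewrite -lee_fin EFin_Rint.
Qed.

Lemma Rint_dct (f_ : nat -> T -> R) f g :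
  (forall n, measurable_fun setT (f_ n)) ->
  (forall x, f_ ^~ x @ \oo --> f x) -> itg g ->
  (forall n x, `|f_ n x| <= g x) ->
  itg f /\ (fun n => \int[mu]_x f_ n x) @ \oo --> \int[mu]_x f x.
Proof.
move=> mf cf gi fg.
have mf' : measurable_fun setT f.
  by apply: (measurable_fun_cvg (h := f_)) => // x _; exact: cf.
have [] := @dominated_convergence _ _ _ mu setT measurableT
  (fun n => EFin \o f_ n) (EFin \o f) (EFin \o g).
- by move=> n; exact/measurable_EFinP.
- exact/measurable_EFinP.
- by apply: aeW => x _ /=; apply: cvg_EFin; [exact: nearW|exact: cf].
- exact: gi.
- by apply: aeW => x n _ /=; rewrite lee_fin fg.
move=> fi _ cv; split => //.
apply: fine_cvg; rewrite EFin_Rint//.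
Qed.

Lemma Rint_fatou (f_ : nat -> T -> R) f (c : nat -> R) (l : R) :
  (forall n, measurable_fun setT (f_ n)) -> (forall n x, 0 <= f_ n x) ->
  (forall x, f_ ^~ x @ \oo --> f x) ->
  (forall n, itg (f_ n)) -> (forall n, \int[mu]_x f_ n x <= c n) ->
  c @ \oo --> l -> itg f /\ \int[mu]_x f x <= l.
Proof.
move=> mf f0 cf fi fc cl.
have mf' : measurable_fun setT f.
  by apply: (measurable_fun_cvg (h := f_)) => // x _; exact: cf.
apply: ge0_itg_fin => //.
  by move=> x; apply: (cvgr_to_ge (cf x)); exact: nearW.
apply: (le_trans _ (_ : limn_einf (fun n => \int[mu]_x (f_ n x)%:E) <= _)%E).
  have <- : (\int[mu]_x limn_einf (fun n => (f_ n x)%:E) =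
             \int[mu]_x (f x)%:E)%E.
    apply: eq_integral => x _.
    have h : (fun n => (f_ n x)%:E) @ \oo --> (f x)%:E.
      by apply: cvg_EFin; [exact: nearW|exact: cf].
    rewrite is_cvg_limn_einfE; last by apply/cvg_ex; exists (f x)%:E.
    exact/cvg_lim.
  apply: (fatou mu measurableT) => [n|n x _]; last by rewrite lee_fin.
  exact/measurable_EFinP.
have h : (EFin \o c) @ \oo --> l%:E.
  by apply: cvg_EFin; [exact: nearW|exact: cl].
have <- : limn_einf (EFin \o c) = l%:E.
  rewrite is_cvg_limn_einfE; last by apply/cvg_ex; exists l%:E.
  exact/cvg_lim.
rewrite !limn_einf_lim; apply: lee_lim; [exact: is_cvg_einfs|exact: is_cvg_einfs|].
apply: nearW => n; apply: le_ereal_inf_tmp => _ [m /= nm <-].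
rewrite (le_trans _ (_ : (\int[mu]_x (f_ m x)%:E <= (c m)%:E)%E))//.
  by apply: ereal_inf_lbound; exists m.
by rewrite -EFin_Rint// lee_fin.
Qed.

End real_integrals.

Lemma itg_bounded d (T : measurableType d) (R : realType)
    (P : probability T R) (f : T -> R) (M : R) :
  measurable_fun setT f -> (forall x, `|f x| <= M) ->
  P.-integrable setT (EFin \o f).
Proof.
move=> mf fM; apply: (itg_le mf _ fM).
by apply: finite_measure_integrable_cst.
Qed.

Lemma Rint_prob_cst d (T : measurableType d) (R : realType)
    (P : probability T R) (c : R) : \int[P]_x c = c.
Proof. by rewrite Rintegral_cst//= probability_setT/= mulr1. Qed.


Lemma measurable_pos_inv d (T : measurableType d) (R : realType) (f : T -> R) :
  measurable_fun setT f -> (forall x, 0 < f x) ->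
  measurable_fun setT (fun x => (f x)^-1).
Proof.
move=> mf f0; rewrite (_ : (fun x => _) = fun x => expR (- ln (f x))).
  apply: measurableT_comp => //; apply: measurable_funN.
  exact: measurableT_comp.
by apply/funext => x; rewrite expRN lnK// posrE.
Qed.

Lemma cvg_inv_nat (R : realType) : (fun n => n.+1%:R^-1 : R) @ \oo --> (0 : R).
Proof. exact: cvg_harmonic. Qed.

Lemma le_perturb (R : realType) (a b c : R) : (forall t : R, 0 < t -> t <= 1 -> a <= b + c * t) ->
  a <= b.
Proof.
move=> h; have : (fun n => b + c * n.+1%:R^-1 : R) @ \oo --> b + c * 0.
  apply: cvgD; first exact: cvg_cst.
  by apply: cvgM; [exact: cvg_cst|exact: cvg_inv_nat].
rewrite mulr0 addr0 => /cvgr_to_ge; apply; apply: nearW => n.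
by apply: h; rewrite ?invr_gt0// invf_le1// ler1n.
Qed.

(** The hypothesis has the shape that minimising sequences produce: two elements whose gap to the
    infimum is at most [1 / (n + 1)] are at squared distance of that order. *)
Lemma cvg_sqr_dist (R : realType) (u : nat -> R) (c : R) :
  (forall n m, (n <= m)%N -> (u n - u m) ^+ 2 <= c * n.+1%:R^-1) ->
  cvg (u @ \oo).
Proof.
move=> h; apply/cauchy_cvgP; apply/cauchy_ballP => e e0; near_simpl.
have he : 0 < e ^+ 2 / 4 by rewrite divr_gt0// exprn_gt0.
have [N hN] : exists N, c * N.+1%:R^-1 < e ^+ 2 / 4.
  have : (fun n => c * n.+1%:R^-1 : R) @ \oo --> (c * 0 : R).
    by apply: cvgM; [exact: cvg_cst|exact: cvg_inv_nat].
  rewrite mulr0 => /cvgrPdist_lt /(_ _ he) [N _ /(_ N (leqnn N))] /=.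
  by rewrite sub0r normrN => /(le_lt_trans (ler_norm _)) ?; exists N.
have key n : (N <= n)%N -> `|u N - u n| < e / 2.
  move=> Nn; rewrite -(ltr_pXn2r (n := 2))// ?nnegrE ?divr_ge0 ?ltW//.
  rewrite real_normK ?num_real// (le_lt_trans (h _ _ Nn))// (lt_le_trans hN)//.
  by rewrite expr_div_n (_ : 2 ^+ 2 = 4)//; ring.
exists (setT `&` [set n | (N <= n)%N], [set n | (N <= n)%N]); first split.
- by exists N => // n /= ?; split.
- by exists N.
move=> [n m] /= [[_ Nn] Nm]; rewrite /ball /=.
rewrite (_ : u n - u m = (u N - u m) - (u N - u n)); last by ring.
by rewrite (le_lt_trans (ler_normB _ _))// (splitr e) ltrD// key.
Unshelve. all: by end_near. Qed.

Lemma measurable_Rint d1 d2 (T1 : measurableType d1) (T2 : measurableType d2)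
    (R : realType) (P : probability T2 R) (f : T1 -> T2 -> R) :
  measurable_fun setT (fun z : T1 * T2 => f z.1 z.2) ->
  (forall x y, 0 <= f x y) ->
  measurable_fun setT (fun x => \int[P]_y f x y).
Proof.
move=> mf f0; rewrite /Rintegral; apply: measurableT_comp => //.
apply: (@measurable_fun_fubini_tonelli_F _ _ _ _ _ P (fun z => (f z.1 z.2)%:E)) => //.
- exact/measurable_EFinP.
- by move=> z; rewrite lee_fin.
Qed.

Lemma measurable_curry2 d1 d2 d3 (T1 : measurableType d1) (T2 : measurableType d2)
    (T3 : measurableType d3) (f : T1 -> T2 -> T3) y :
  measurable_fun setT (fun z : T1 * T2 => f z.1 z.2) ->
  measurable_fun setT (f ^~ y).
Proof. by move=> mf; exact: (measurableT_comp mf (pair2_measurable y)). Qed.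

(** * Vectors of a reproducing kernel space *)

Section kernel_lists.
Context (R : realType) (T : Type) (k : T -> T -> R).
Implicit Types (s t : seq (R * T)) (x : T).

(* A list of weighted points stands for the vector [sum c_i k(., x_i)] of the
   reproducing kernel space of [k]; [kfun] evaluates it, [kip] is the inner
   product. *)
Definition kfun s x := \sum_(p <- s) p.1 * k x p.2.
Definition kip s t := \sum_(p <- s) p.1 * kfun t p.2.
Definition lscale (c : R) s := [seq (c * p.1, p.2) | p <- s].

Definition psd_kernel := (forall x y, k x y = k y x) /\
  forall s, 0 <= kip s s.

Lemma kfun_cat s t x : kfun (s ++ t) x = kfun s x + kfun t x.
Proof. by rewrite /kfun big_cat. Qed.

Lemma kfun_scale c s x : kfun (lscale c s) x = c * kfun s x.
Proof. by rewrite /kfun big_map mulr_sumr; apply: eq_bigr => p _; rewrite mulrA. Qed.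

Lemma kfun1 c y x : kfun [:: (c, y)] x = c * k x y.
Proof. by rewrite /kfun big_seq1. Qed.

Lemma kip_catl s t u : kip (s ++ t) u = kip s u + kip t u.
Proof. by rewrite /kip big_cat. Qed.

Lemma kip_catr s t u : kip u (s ++ t) = kip u s + kip u t.
Proof.
by rewrite /kip -big_split; apply: eq_bigr => p _ /=; rewrite kfun_cat mulrDr.
Qed.

Lemma kip_scalel c s t : kip (lscale c s) t = c * kip s t.
Proof. by rewrite /kip big_map mulr_sumr; apply: eq_bigr => p _; rewrite mulrA. Qed.

Lemma kip_scaler c s t : kip s (lscale c t) = c * kip s t.
Proof.
rewrite /kip mulr_sumr; apply: eq_bigr => p _.
by rewrite kfun_scale mulrCA.
Qed.

Lemma kip1l c y s : kip [:: (c, y)] s = c * kfun s y.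
Proof. by rewrite /kip big_seq1. Qed.

Hypothesis kpsd : psd_kernel.

Lemma kipC s t : kip s t = kip t s.
Proof.
rewrite /kip; under eq_bigr do rewrite mulr_sumr.
rewrite exchange_big; apply: eq_bigr => p _; rewrite /kfun mulr_sumr.
apply: eq_bigr => q _ /=; rewrite (kpsd.1 q.2) mulrCA//.
Qed.

Hypothesis k1 : forall x, k x x = 1.

(** Cauchy-Schwarz against the unit vector [k(., x)]: the squared norm of [v - v(x) k(., x)] is
    [|v|^2 - v(x)^2]. *)
Lemma kfun_sqr_le s x : kfun s x ^+ 2 <= kip s s.
Proof.
have := kpsd.2 (s ++ [:: (- kfun s x, x)]).
rewrite kip_catl !kip_catr kip1l (kipC s [:: _]) !kip1l kfun1 k1.
set a := kfun s x; set b := kip s s; nra.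
Qed.

(** For unit vectors [|s - t|^2 = 2 - 2 <s, t>], and this norm dominates the value of [s - t] at any
    point. *)
Lemma kfun_dist s t x : kip s s = 1 -> kip t t = 1 ->
  kip s t <= 1 - (kfun s x - kfun t x) ^+ 2 / 2.
Proof.
move=> s1 t1; have := kfun_sqr_le (s ++ lscale (-1) t) x.
rewrite kfun_cat kfun_scale kip_catl !kip_catr !kip_scalel !kip_scaler.
rewrite (kipC t s) s1 t1.
set a := kfun s x; set b := kfun t x; set c := kip s t; lra.
Qed.

Lemma psd_kernel_le1 x y : k x y <= 1.
Proof.
have := kfun_sqr_le [:: (1, y)] x.
rewrite kip1l !kfun1 !mul1r k1; set a := k x y => ?; nra.
Qed.

End kernel_lists.

(** * Schroedinger potentials *)

Section potential.
Context d (T : measurableType d) (R : realType).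
Variables (k : T -> T -> R) (P : probability T R).
Implicit Types (s t : seq (R * T)) (x y : T).

Local Notation itg f := (P.-integrable setT (EFin \o f)).

Definition good_kernel := [/\ psd_kernel k, forall x y, 0 < k x y,
  forall x, k x x = 1 & measurable_fun setT (fun z : T * T => k z.1 z.2)].

(* [h] solves the Schroedinger equation of [P], and is the limit of the unit
   vectors [s_ n] of the reproducing kernel space of [k] *)
Definition is_potential (h : T -> R) (s_ : nat -> seq (R * T)) :=
  [/\ measurable_fun setT h, forall x, 0 < h x <= 1,
      forall x, itg (fun y => k x y / h y) /\ \int[P]_y (k x y / h y) = h x,
      forall n p, p \in s_ n -> 0 < p.1 &
      (forall n, kip k (s_ n) (s_ n) = 1) /\
      forall x, (fun n => kfun k (s_ n) x) @ \oo --> h x].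

(** This is [0 <= |v - u|^2] expanded, with [v] the vector of [s] and [u] the integral of
    [w(y) k(., y)]; it is stated through integrals only, so that [u] need not exist as an object. *)
Definition psd_integral := forall (w : T -> R) (M : R) s,
  measurable_fun setT w -> (forall x, 0 <= w x <= M) ->
  2 * \int[P]_y (kfun k s y * w y) <=
  kip k s s + \int[P]_x (w x * \int[P]_y (k x y * w y)).

Variable low : T -> R.
Hypothesis gk : good_kernel.
Hypothesis lnk : forall y, itg (fun x => ln (k x y)).
Hypothesis low_gt0 : forall x, 0 < low x.
Hypothesis low_le : forall x, low x <= \int[P]_y k x y.
Hypothesis pint : psd_integral.

Let kpsd : psd_kernel k. Proof. by case: gk. Qed.
Let k0 x y : 0 < k x y. Proof. by case: gk. Qed.
Let k1 x : k x x = 1. Proof. by case: gk. Qed.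
Let mkk : measurable_fun setT (fun z : T * T => k z.1 z.2).
Proof. by case: gk. Qed.
Let mk y : measurable_fun setT (k ^~ y). Proof. exact: measurable_curry2. Qed.
Let kC x y : k x y = k y x. Proof. by case: kpsd. Qed.
Let kle1 x y : k x y <= 1. Proof. exact: psd_kernel_le1. Qed.

Let mkr x : measurable_fun setT (k x).
Proof. by rewrite (_ : k x = k ^~ x)//; apply/funext => y; rewrite kC. Qed.

Lemma measurable_kfun s : measurable_fun setT (kfun k s).
Proof.
apply: measurable_sum => p; apply: measurable_funM => //.
Qed.

Lemma itg_k x : itg (k x).
Proof. by apply: (@itg_bounded _ _ _ _ _ 1) => // y; rewrite gtr0_norm. Qed.

Definition pos s := (s != [::]) && all (fun p => 0 < p.1) s.

Lemma pos_cat s t : pos s -> pos t -> pos (s ++ t).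
Proof. by case: s => // p s /andP[_ /= h] /andP[_ h']; rewrite /pos/= all_cat andbA h h'. Qed.

Lemma pos1 c x : 0 < c -> pos [:: (c, x)].
Proof. by move=> c0; rewrite /pos/= c0. Qed.

Lemma pos_scale c s : 0 < c -> pos s -> pos (lscale c s).
Proof.
move=> c0 /andP[s0 sp]; rewrite /pos -size_eq0 size_map size_eq0 s0/=.
by rewrite all_map; apply: sub_all sp => p /=; rewrite pmulr_rgt0.
Qed.

Lemma pos_kfun_gt0 s x : pos s -> 0 < kfun k s x.
Proof.
case: s => // p s /andP[_ /= /andP[p0 sp]]; rewrite /kfun big_cons.
rewrite ltr_pwDl ?mulr_gt0//; rewrite big_seq; apply: sumr_ge0 => q qs.
by rewrite mulr_ge0// ltW//; exact: (allP sp).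
Qed.

Lemma kfun_ge0 s x : all (fun p => 0 < p.1) s -> 0 <= kfun k s x.
Proof.
move=> sp; rewrite /kfun big_seq; apply: sumr_ge0 => q qs.
by rewrite mulr_ge0// ltW//; exact: (allP sp).
Qed.

Lemma pos_kip_gt0 s : pos s -> 0 < kip k s s.
Proof.
move=> sp; have [p _] : exists p : R * T, True by case: s sp => // p s; exists p.
apply: lt_le_trans (kfun_sqr_le kpsd k1 s p.2).
by rewrite exprn_gt0// pos_kfun_gt0.
Qed.

(** A single term of the list bounds the logarithm from below, and the norm of the vector bounds it
    from above. *)
Lemma itg_lnkfun s : pos s -> itg (fun x => ln (kfun k s x)).
Proof.
case: s => // p s sp.
have p0 : 0 < p.1 by case/andP: sp => _ /= /andP[].
have mf : measurable_fun setT (fun x => ln (kfun k (p :: s) x)).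
  exact: (measurableT_comp (@measurable_ln R) (measurable_kfun _)).
pose N := ln (kip k (p :: s) (p :: s)).
apply: (@itg_between _ _ _ _ (fun x => ln p.1 + ln (k x p.2))
   (fun x => N / 2) _ mf).
- apply: itgD => //; apply: (@itg_bounded _ _ _ _ _ `|ln p.1|) => //.
- apply: (@itg_bounded _ _ _ _ _ `|N / 2|) => //.
move=> x; apply/andP; split.
  rewrite -lnM ?posrE// ler_ln ?posrE ?mulr_gt0 ?pos_kfun_gt0//.
  rewrite /kfun big_cons lerDl; apply: kfun_ge0.
  by case/andP: sp => _ /= /andP[].
rewrite ler_pdivlMr// mulr_natr -lnXn ?pos_kfun_gt0//.
rewrite ler_ln ?posrE ?pos_kip_gt0 ?exprn_gt0 ?pos_kfun_gt0//.
exact: kfun_sqr_le.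
Qed.

(* The scale-invariant form of [|v|^2 / 2 - int ln v dP]. *)
Definition logfun s := ln (kip k s s) / 2 - \int[P]_x ln (kfun k s x).

Lemma logfun_ge0 s : pos s -> 0 <= logfun s.
Proof.
move=> sp; rewrite /logfun subr_ge0.
rewrite -[leRHS](Rint_prob_cst P); apply: le_Rintegral => //.
- exact: itg_lnkfun.
- by apply: (@itg_bounded _ _ _ _ _ `|ln (kip k s s) / 2|) => //.
move=> x _; rewrite ler_pdivlMr// mulr_natr -lnXn ?pos_kfun_gt0//.
rewrite ler_ln ?posrE ?pos_kip_gt0 ?exprn_gt0 ?pos_kfun_gt0//.
exact: kfun_sqr_le.
Qed.

Lemma logfun_scale c s : 0 < c -> pos s -> logfun (lscale c s) = logfun s.
Proof.
move=> c0 sp; rewrite /logfun kip_scalel kip_scaler.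
have N0 := pos_kip_gt0 sp.
rewrite !lnM ?posrE ?mulr_gt0//.
have -> : \int[P]_x ln (kfun k (lscale c s) x) =
    ln c + \int[P]_x ln (kfun k s x).
  rewrite -[X in X + _](Rint_prob_cst P) -RintegralD//; last 2 first.
    by apply: (@itg_bounded _ _ _ _ _ `|ln c|) => //.
    exact: itg_lnkfun.
  apply: eq_Rintegral => x _.
  by rewrite kfun_scale lnM ?posrE// pos_kfun_gt0.
lra.
Qed.

Let I := inf [set logfun s | s in [set s | pos s]].

Lemma logfun_inf s : pos s -> I <= logfun s.
Proof.
move=> sp; apply: ge_inf; last by exists s.
by exists 0 => _ [t tp <-]; exact: logfun_ge0.
Qed.

Lemma logfun_min (x0 : T) n : exists s, [/\ pos s, kip k s s = 1 &
  logfun s <= I + n.+1%:R^-1].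
Proof.
have hI : has_inf [set logfun s | s in [set s | pos s]].
  split; first by exists (logfun [:: (1, x0)]); exists [:: (1, x0)] => //; exact: pos1.
  by exists 0 => _ [t tp <-]; exact: logfun_ge0.
have n0 : (0 : R) < n.+1%:R^-1 by rewrite invr_gt0.
have [_ [s sp <-] /ltW sI] := inf_adherent n0 hI.
have N0 := pos_kip_gt0 sp.
have c0 : 0 < (Num.sqrt (kip k s s))^-1 by rewrite invr_gt0 sqrtr_gt0.
exists (lscale (Num.sqrt (kip k s s))^-1 s); split.
- exact: pos_scale.
- rewrite kip_scalel kip_scaler mulrA -expr2 exprVn sqr_sqrtr ?ltW//.
  by rewrite mulVf// gt_eqF.
- by rewrite logfun_scale.
Qed.

(** Strict convexity, tested at [s + t]. With [c = <s, t>], its squared norm is [2 (1 + c)], and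
    AM-GM gives [ln 2] plus the mean of the two logarithms as a lower bound of its logarithm.
    Minimality leaves [ln ((1 + c) / 2) >= - 2 dl], while [ln z <= z - 1] bounds the left side by
    [(c - 1) / 2]. *)
Lemma logfun_cauchy s t dl : pos s -> pos t -> kip k s s = 1 -> kip k t t = 1 ->
  logfun s <= I + dl -> logfun t <= I + dl -> 1 - 4 * dl <= kip k s t.
Proof.
move=> sp tp s1 t1 sI tI.
have stp := pos_cat sp tp.
have := logfun_inf stp; move: sI tI.
have c0 := pos_kip_gt0 stp.
move: c0; rewrite /logfun kip_catl !kip_catr (kipC kpsd t s) s1 t1.
rewrite !ln1 !mul0r !sub0r.
have : ln 2 + (\int[P]_x ln (kfun k s x) + \int[P]_x ln (kfun k t x)) / 2 <=
       \int[P]_x ln (kfun k (s ++ t) x).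
  rewrite -RintegralD ?itg_lnkfun// -RintegralZr//; last first.
    by apply: itgD; exact: itg_lnkfun.
  rewrite -[X in X + _](Rint_prob_cst P) -RintegralD//; last 2 first.
    by apply: (@itg_bounded _ _ _ _ _ `|ln 2|) => //.
    apply: eq_integrable (itgZ 2^-1 (itgD (itg_lnkfun sp) (itg_lnkfun tp))) => //.
    by move=> x _ /=; rewrite mulrC.
  apply: le_Rintegral => //.
  - apply: itgD; first by apply: (@itg_bounded _ _ _ _ _ `|ln 2|) => //.
    apply: eq_integrable (itgZ 2^-1 (itgD (itg_lnkfun sp) (itg_lnkfun tp))) => //.
    by move=> x _ /=; rewrite mulrC.
  - exact: itg_lnkfun.
  move=> x _; rewrite kfun_cat.
  have a0 := pos_kfun_gt0 x sp; have b0 := pos_kfun_gt0 x tp.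
  set a := kfun k s x in a0 *; set b := kfun k t x in b0 *.
  suff : ln (4 * (a * b)) <= ln ((a + b) ^+ 2).
    rewrite lnM ?posrE ?mulr_gt0// lnM ?posrE// lnXn ?addr_gt0//.
    by rewrite (_ : 4 = 2 ^+ 2)// ?lnXn//; lra.
  rewrite ler_ln ?posrE ?mulr_gt0 ?exprn_gt0 ?addr_gt0//.
  have := sqr_ge0 (a - b); nra.
set c := kip k s t; set u := \int[P]_x ln (kfun k (s ++ t) x).
set a := \int[P]_x _; set b := \int[P]_x _.
move=> h c0 h1 h2 h3.
have c1 : 0 < 1 + c by lra.
have : ln (1 + 1 * c + (c + 1)) = ln 2 + ln (1 + c).
  by rewrite -lnM ?posrE//; congr ln; ring.
rewrite mul1r => hc.
have hl : ln ((1 + c) / 2) <= (1 + c) / 2 - 1.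
  rewrite -[X in ln X](addrNK 1) addrC; apply: le_ln1Dx; lra.
rewrite lnM ?posrE ?invr_gt0// lnV ?posrE// in hl.
have h3' : I <= ln (1 + c + (c + 1)) / 2 - u by exact: h3.
rewrite hc in h3'; lra.
Qed.


Lemma logfun_dist s t dl x : pos s -> pos t ->
  kip k s s = 1 -> kip k t t = 1 ->
  logfun s <= I + dl -> logfun t <= I + dl ->
  (kfun k s x - kfun k t x) ^+ 2 <= 8 * dl.
Proof.
move=> sp tp s1 t1 sI tI.
have := logfun_cauchy sp tp s1 t1 sI tI.
have := kfun_dist kpsd k1 x s1 t1; lra.
Qed.

(** First order condition in the direction [k(., x)]. The error [t / 2] is the quadratic term
    [|t k(., x)|^2], and [dl / t] the defect of minimality. Keeping [t k(y, x)] in the denominator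
    makes the integrand bounded by [1 / t], so that limits can be taken before anything is known on
    the size of [1 / h]. *)
Lemma logfun_variation s x (t dl : R) : pos s -> kip k s s = 1 ->
  logfun s <= I + dl -> 0 < t ->
  \int[P]_y (k y x / (kfun k s y + t * k y x)) <= kfun k s x + t / 2 + dl / t.
Proof.
move=> sp s1 sI t0.
have stp := pos_cat sp (pos1 x t0).
have h0 y := pos_kfun_gt0 y sp.
have hk0 y : 0 < kfun k s y + t * k y x by rewrite addr_gt0// mulr_gt0.
have := logfun_inf stp; move: sI.
rewrite /logfun kip_catl !kip_catr (kipC kpsd [:: _] s) kip1l.
have -> : kip k s [:: (t, x)] = t * kfun k s x by rewrite (kipC kpsd) kip1l.
rewrite kfun1 k1 mulr1 s1 ln1 mul0r sub0r.
set a := \int[P]_y ln _; set b := \int[P]_y ln _ => h1 h2.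
have mq : measurable_fun setT (fun y => k y x / (kfun k s y + t * k y x)).
  apply: measurable_funM => //; apply: measurable_pos_inv => //.
  by apply: measurable_funD; [exact: measurable_kfun|exact: measurable_funM].
have iq : itg (fun y => k y x / (kfun k s y + t * k y x)).
  apply: (@itg_bounded _ _ _ _ _ t^-1) => // y.
  rewrite ger0_norm; last by rewrite divr_ge0// ltW.
  rewrite ler_pdivrMr// ler_pdivlMl//.
  by rewrite lerDr ltW.
have h3 : t * \int[P]_y (k y x / (kfun k s y + t * k y x)) <= b - a.
  rewrite -RintegralZl// -RintegralB//; [|exact: itg_lnkfun..].
  apply: le_Rintegral => //; first exact: itgZ.
    by apply: itgB; exact: itg_lnkfun.
  move=> y _; rewrite kfun_cat kfun1.
  have := h0 y; have := hk0 y.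
  set u := kfun k s y; set v := t * k y x => uv0 u0.
  (* Concavity of [ln] in the form [ln (u + v) - ln u >= v / (u + v)]. *)
  have : ln (1 + - (v / (u + v))) <= - (v / (u + v)).
    apply: le_ln1Dx; rewrite ltrN2 ltr_pdivrMr// mul1r; lra.
  have -> : 1 + - (v / (u + v)) = u / (u + v) by field; rewrite gt_eqF.
  rewrite ln_div ?posrE// mulrA -/v; lra.
have h4 : ln (1 + t * kfun k s x + (t * kfun k s x + t * t)) <=
   t * kfun k s x + (t * kfun k s x + t * t).
  rewrite -addrA; apply: le_ln1Dx.
  by rewrite (lt_le_trans (ltrN10 _))// !addr_ge0 ?mulr_ge0// ltW.
rewrite -(ler_pM2l t0) !mulrDr (mulrCA t dl) mulfV ?gt_eqF// mulr1; lra.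
Qed.

Section limit.
Variable s_ : nat -> seq (R * T).
Hypothesis s_pos : forall n, pos (s_ n).
Hypothesis s_1 : forall n, kip k (s_ n) (s_ n) = 1.
Hypothesis s_min : forall n, logfun (s_ n) <= I + n.+1%:R^-1.

Let h x := lim ((fun n => kfun k (s_ n) x) @ \oo).

Let s_h x : (fun n => kfun k (s_ n) x) @ \oo --> h x.
Proof.
apply: (@cvg_sqr_dist _ _ 8) => n m nm; apply: logfun_dist => //.
by rewrite (le_trans (s_min _))// lerD2l lef_pV2 ?posrE// ler_nat.
Qed.

Let mh : measurable_fun setT h.
Proof.
apply: (@measurable_fun_cvg _ _ _ _ (fun n => kfun k (s_ n))) => [n|x _].
  exact: measurable_kfun.
exact: s_h.
Qed.

Let hge0 x : 0 <= h x.
Proof.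
by apply: (cvgr_to_ge (s_h (x := x))); apply: nearW => n; rewrite ltW// pos_kfun_gt0.
Qed.

Let s_le1 n x : kfun k (s_ n) x <= 1.
Proof.
have := kfun_sqr_le kpsd k1 (s_ n) x; rewrite s_1.
have := pos_kfun_gt0 x (s_pos n); nra.
Qed.

Let hle1 x : h x <= 1.
Proof. by apply: (cvgr_to_le (s_h (x := x))); exact: nearW. Qed.

Let htk x (t : R) y : 0 < t -> 0 < h y + t * k y x.
Proof. by move=> t0; rewrite ltr_wpDl// mulr_gt0. Qed.

Let mq (g : T -> R) x (t : R) : measurable_fun setT g -> (forall y, 0 <= g y) -> 0 < t ->
  measurable_fun setT (fun y => k y x / (g y + t * k y x)).
Proof.
move=> mg g0 t0; apply: measurable_funM => //; apply: measurable_pos_inv => [|y].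
  by apply: measurable_funD => //; exact: measurable_funM.
by rewrite ltr_wpDl// mulr_gt0.
Qed.

Let q_bd (g : T -> R) x (t : R) y : (forall y, 0 <= g y) -> 0 < t ->
  `|k y x / (g y + t * k y x)| <= t^-1.
Proof.
move=> g0 t0; have gt : 0 < g y + t * k y x by rewrite ltr_wpDl// mulr_gt0.
rewrite ger0_norm; last by rewrite divr_ge0// ltW.
by rewrite ler_pdivrMr// ler_pdivlMl// lerDr.
Qed.

(** The order of limits matters: [n] goes to infinity with [t] fixed, which removes the term
    [dl / t]; only afterwards may [t] tend to 0. *)
Let h_variation x (t : R) : 0 < t ->
  \int[P]_y (k y x / (h y + t * k y x)) <= h x + t / 2.
Proof.
move=> t0.
have [] := @Rint_dct _ _ _ P (fun n y => k y x / (kfun k (s_ n) y + t * k y x))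
  (fun y => k y x / (h y + t * k y x)) (cst t^-1).
- move=> n; apply: mq => //; first exact: measurable_kfun.
  by move=> y; rewrite ltW// pos_kfun_gt0.
- move=> y; apply: cvgM; first exact: cvg_cst.
  apply: cvgV; first by rewrite gt_eqF// htk.
  by apply: cvgD; [exact: s_h|exact: cvg_cst].
- exact: finite_measure_integrable_cst.
- by move=> n y; apply: q_bd => // z; rewrite ltW// pos_kfun_gt0.
move=> _ cv.
have cvr : (fun n => kfun k (s_ n) x + t / 2 + n.+1%:R^-1 / t) @ \oo -->
    h x + t / 2 + 0 / t.
  apply: cvgD; first by apply: cvgD; [exact: s_h|exact: cvg_cst].
  by apply: cvgM; [exact: cvg_inv_nat|exact: cvg_cst].
rewrite mul0r addr0 in cvr; apply: (ler_cvg_to cv cvr).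
by apply: nearW => n; exact: logfun_variation.
Qed.

(** This keeps the limit away from 0. As [h <= 1], the denominator in [h_variation] is at most
    [1 + t]. The slope 2 comes from [(1 + t) (h + t / 2) <= h + 2 t] for [h] and [t] at most 1. *)
Let h_low x : low x <= h x.
Proof.
apply: (@le_perturb _ _ _ 2) => t t0 t1.
have h1 : (1 + t)^-1 * \int[P]_y k x y <= h x + t / 2.
  apply: le_trans (h_variation x t0).
  rewrite -RintegralZl//; last exact: itg_k.
  apply: le_Rintegral => //; first by apply: itgZ; exact: itg_k.
    apply: (@itg_bounded _ _ _ _ _ t^-1); first exact: mq.
    by move=> y; exact: q_bd.
  move=> y _; rewrite mulrC (kC x y); apply: ler_wpM2l; first exact: ltW.
  have t1_gt0 : 0 < 1 + t by exact: addr_gt0.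
  rewrite lef_pV2 ?posrE ?htk//.
  by rewrite lerD// ler_piMr// ltW.
rewrite ler_pdivrMl ?addr_gt0// in h1.
apply: (le_trans (low_le x)); apply: (le_trans h1).
have := hle1 x; have := hge0 x; nra.
Qed.

Let h_gt0 x : 0 < h x. Proof. exact: lt_le_trans (low_gt0 x) (h_low x). Qed.

(** Letting [t = 1 / (n + 1)] tend to 0 in [h_variation]. Fatou is used because no integrable
    majorant of [k(x, .) / h] is available yet; this lemma supplies one. *)
Let h_sub x : itg (fun y => k x y / h y) /\ \int[P]_y (k x y / h y) <= h x.
Proof.
apply: (@Rint_fatou _ _ _ P (fun n y => k y x / (h y + n.+1%:R^-1 * k y x)) _
  (fun n => h x + n.+1%:R^-1 / 2)).
- by move=> n; apply: mq.
- by move=> n y; rewrite divr_ge0// ltW// htk.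
- move=> y; rewrite (kC x y); apply: cvgM; first exact: cvg_cst.
  apply: cvgV; first by rewrite gt_eqF.
  rewrite -[X in _ --> X]addr0; apply: cvgD; first exact: cvg_cst.
  rewrite -[X in _ --> X](mul0r (k y x)).
  by apply: cvgM; [exact: cvg_inv_nat|exact: cvg_cst].
- move=> n; apply: (@itg_bounded _ _ _ _ _ (n.+1%:R^-1)^-1); first exact: mq.
  by move=> y; exact: q_bd.
- by move=> n; apply: h_variation.
rewrite -[X in _ --> X]addr0; apply: cvgD; first exact: cvg_cst.
rewrite -[X in _ --> X](mul0r 2^-1).
by apply: cvgM; [exact: cvg_inv_nat|exact: cvg_cst].
Qed.

(** Truncations of [1 / h]: bounded, as [psd_integral] requires, and increasing to [1 / h]. *)
Let w m x := (h x + m.+1%:R^-1)^-1.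

Let hm_gt0 m x : 0 < h x + m.+1%:R^-1.
Proof. by rewrite ltr_wpDl. Qed.

Let w_gt0 m x : 0 < w m x. Proof. by rewrite invr_gt0. Qed.

Let mw m : measurable_fun setT (w m).
Proof. by apply: measurable_pos_inv => //; exact: measurable_funD. Qed.

Let w_le m x : w m x <= m.+1%:R.
Proof. by rewrite -[leRHS]invrK lef_pV2 ?posrE// lerDr. Qed.

Let w_leV m x : w m x <= (h x)^-1.
Proof. by rewrite lef_pV2 ?posrE// lerDl. Qed.

Let w_cvg x : (fun m => w m x) @ \oo --> (h x)^-1.
Proof.
apply: cvgV; first by rewrite gt_eqF.
rewrite -[X in _ --> X]addr0; apply: cvgD; first exact: cvg_cst.
exact: cvg_inv_nat.
Qed.

Let itg_kw m x : itg (fun y => k x y * w m y).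
Proof.
apply: (@itg_bounded _ _ _ _ _ m.+1%:R); first exact: measurable_funM.
move=> y; rewrite ger0_norm; last by rewrite mulr_ge0// ltW.
by rewrite -[leRHS]mul1r ler_pM// ltW.
Qed.

Let hw_le1 m x : 0 <= h x * w m x <= 1.
Proof.
apply/andP; split; first by rewrite mulr_ge0// ltW.
by rewrite /w ler_pdivrMr// mul1r lerDl.
Qed.

Let itg_hw m : itg (fun y => h y * w m y).
Proof.
apply: (@itg_bounded _ _ _ _ _ 1); first exact: measurable_funM.
by move=> y; have /andP[? ?] := hw_le1 m y; rewrite ger0_norm.
Qed.

Let itg_sw n m : itg (fun y => kfun k (s_ n) y * w m y).
Proof.
apply: (@itg_bounded _ _ _ _ _ m.+1%:R).
  by apply: measurable_funM => //; exact: measurable_kfun.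
move=> y; have := pos_kfun_gt0 y (s_pos n) => s0.
rewrite ger0_norm; last by rewrite mulr_ge0// ltW.
by rewrite -[leRHS]mul1r ler_pM// ltW.
Qed.

(** By [h_sub] the inner integral is at most [h], and [h * w m <= 1]. *)
Let energy_le m : \int[P]_x (w m x * \int[P]_y (k x y * w m y)) <= 1.
Proof.
have le x : \int[P]_y (k x y * w m y) <= h x.
  have [i1 i2] := h_sub x; apply: le_trans i2.
  by apply: le_Rintegral => // y _; rewrite ler_pM2l.
have lew x : w m x * \int[P]_y (k x y * w m y) <= h x * w m x.
  by rewrite mulrC ler_pM2r.
rewrite -[leRHS](Rint_prob_cst P); apply: le_Rintegral => //.
- apply: (@itg_bounded _ _ _ _ _ 1).
    apply: measurable_funM => //.
    apply: (@measurable_Rint _ _ _ _ _ _ (fun x y => k x y * w m y)).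
      apply: measurable_funM => //.
      exact: (measurableT_comp (mw m) measurable_snd).
    by move=> x y; rewrite mulr_ge0// ltW.
  move=> x; rewrite ger0_norm.
    by apply: (le_trans (lew x)); case/andP: (hw_le1 m x).
  apply: mulr_ge0; [exact: ltW|apply: Rintegral_ge0 => y _].
  by rewrite mulr_ge0// ltW.
- exact: finite_measure_integrable_cst.
- by move=> x _; apply: (le_trans (lew x)); case/andP: (hw_le1 m x).
Qed.

(* Positivity of [|s_n + t k(., x0) - int w_m(y) k(., y) dP(y)|^2]; both [h] and the
   integral have norm at most 1. *)
Let h_dual m x0 (t : R) : 2 * (\int[P]_y (h y * w m y)) +
  2 * t * \int[P]_y (k x0 y * w m y) <= 2 + 2 * t * h x0 + t ^+ 2.
Proof.
have [] := @Rint_dct _ _ _ P (fun n y => kfun k (s_ n) y * w m y)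
  (fun y => h y * w m y) (cst m.+1%:R).
- by move=> n; apply: measurable_funM => //; exact: measurable_kfun.
- by move=> y; apply: cvgM; [exact: s_h|exact: cvg_cst].
- exact: finite_measure_integrable_cst.
- move=> n y; have := pos_kfun_gt0 y (s_pos n) => s0.
  rewrite ger0_norm; last by rewrite mulr_ge0// ltW.
  by rewrite -[leRHS]mul1r ler_pM// ltW.
move=> _ cv.
have cvl : (fun n => 2 * (\int[P]_y (kfun k (s_ n) y * w m y)) +
  2 * t * \int[P]_y (k x0 y * w m y)) @ \oo --> 2 * (\int[P]_y (h y * w m y)) +
  2 * t * \int[P]_y (k x0 y * w m y).
  by apply: cvgD; [apply: cvgM => //; exact: cvg_cst|exact: cvg_cst].
have cvr : (fun n => 2 + 2 * t * kfun k (s_ n) x0 + t ^+ 2) @ \oo -->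
   2 + 2 * t * h x0 + t ^+ 2.
  apply: cvgD; last exact: cvg_cst.
  apply: cvgD; first exact: cvg_cst.
  by apply: cvgM; [exact: cvg_cst|exact: s_h].
apply: (ler_cvg_to cvl cvr); apply: nearW => n.
have := @pint (w m) m.+1%:R (s_ n ++ [:: (t, x0)]) (mw m) _.
have -> : \int[P]_y (kfun k (s_ n ++ [:: (t, x0)]) y * w m y) =
   \int[P]_y (kfun k (s_ n) y * w m y) + t * \int[P]_y (k x0 y * w m y).
  rewrite -RintegralZl//.
  rewrite -RintegralD//; last by apply: itgZ; exact: itg_kw.
  by apply: eq_Rintegral => y _; rewrite kfun_cat kfun1 mulrDl mulrA (kC y).
rewrite kip_catl !kip_catr (kipC kpsd [:: _] (s_ n)) s_1.
have -> : kip k (s_ n) [:: (t, x0)] = t * kfun k (s_ n) x0.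
  by rewrite (kipC kpsd) kip1l.
rewrite kip1l kfun1 k1 mulr1 => hp.
have : forall y, 0 <= w m y <= m.+1%:R by move=> y; rewrite w_le ltW.
move=> /hp; have := energy_le m; lra.
Qed.

Let h_eq x : itg (fun y => k x y / h y) /\ \int[P]_y (k x y / h y) = h x.
Proof.
have [ikh ikh_le] := h_sub x; split => //.
have [] := @Rint_dct _ _ _ P (fun m y => h y * w m y) (cst 1) (cst 1).
- by move=> m; exact: measurable_funM.
- move=> y; rewrite -[X in _ --> X](@mulfV _ (h y)) ?gt_eqF//.
  by apply: cvgM; [exact: cvg_cst|exact: w_cvg].
- exact: finite_measure_integrable_cst.
- by move=> m y; have /andP[? ?] := hw_le1 m y; rewrite ger0_norm.
move=> _ cv1.
have [] := @Rint_dct _ _ _ P (fun m y => k x y * w m y)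
  (fun y => k x y / h y) (fun y => k x y / h y).
- by move=> m; exact: measurable_funM.
- by move=> y; apply: cvgM; [exact: cvg_cst|exact: w_cvg].
- exact: ikh.
- move=> m y; rewrite ger0_norm; last by rewrite mulr_ge0// ltW.
  by rewrite ler_pM2l.
move=> _ cv2.
rewrite Rint_prob_cst in cv1.
set K := \int[P]_y (k x y / h y) in cv2 ikh_le *.
have key (t : R) : 2 * 1 + 2 * t * K <= 2 + 2 * t * h x + t ^+ 2.
  have cvl : (fun m => 2 * (\int[P]_y (h y * w m y)) +
      2 * t * \int[P]_y (k x y * w m y)) @ \oo --> 2 * 1 + 2 * t * K.
    apply: cvgD; first by apply: cvgM => //; exact: cvg_cst.
    by apply: cvgM => //; exact: cvg_cst.
  apply: (cvgr_to_le cvl); apply: nearW => m; exact: h_dual.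
(* This value of [t], which is nonpositive, gives [2 (K - h x)^2 <= (K - h x)^2]. *)
have := key (K - h x); have := ikh_le; nra.
Qed.

Lemma minimizing_potential : exists h0, is_potential h0 s_.
Proof.
exists h; split => //.
- by move=> x; rewrite h_gt0 hle1.
- move=> n p; have /andP[_ /allP hs] := s_pos n; exact: hs.
Qed.

End limit.

Lemma exists_potential (x0 : T) : exists h (s_ : nat -> seq (R * T)), is_potential h s_.
Proof.
have /choice[s_ hs] := logfun_min x0.
have [h hh] := @minimizing_potential s_ (fun n => let: And3 a _ _ := hs n in a)
  (fun n => let: And3 _ a _ := hs n in a) (fun n => let: And3 _ _ a := hs n in a).
by exists h, s_.
Qed.

End potential.

Section potential_pair.
Context d (T : measurableType d) (R : realType) (k : T -> T -> R).
Hypothesis gk : good_kernel k.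
Variables (P Q : probability T R) (h g : T -> R) (s_ r_ : nat -> seq (R * T)).
Hypothesis hP : is_potential k P h s_.
Hypothesis gQ : is_potential k Q g r_.

(** The integral of [h / g] against [Q] plays the role of [<h, g>]: by the equation of [g], the
    integral of [k(x, .) / g] is [g(x)], so for the list [s_ n] it is the limit of [<s_ n, r_ m>] in
    [m], where [kfun_dist] applies. Fatou then replaces [s_ n] by [h], which uses the positivity of
    the weights. *)
Lemma potential_pair x :
  Q.-integrable setT (EFin \o (fun y => h y / g y)) /\
  \int[Q]_y (h y / g y) <= 1 - (h x - g x) ^+ 2 / 2.
Proof.
have [kpsd k0 k1 mkk] := gk; have kC := kpsd.1.
have [mh h01 hE spos [s1 sh]] := hP; have [mg g01 gE rpos [r1 rg]] := gQ.
have g0 y : 0 < g y by case/andP: (g01 y).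
have mgV : measurable_fun setT (fun y => (g y)^-1) by exact: measurable_pos_inv.
have mk y : measurable_fun setT (k ^~ y) by exact: measurable_curry2.
have fE s : Q.-integrable setT (EFin \o (fun y => kfun k s y / g y)) /\
    \int[Q]_y (kfun k s y / g y) = \sum_(p <- s) p.1 * g p.2.
  have e y : kfun k s y / g y = \sum_(p <- s) p.1 * (k p.2 y / g y).
    by rewrite /kfun mulr_suml; apply: eq_bigr => p _; rewrite mulrA (kC y).
  have i p : Q.-integrable setT (EFin \o (fun y => p.1 * (k p.2 y / g y))).
    by apply: itgZ; case: (gE p.2).
  split.
    apply: eq_integrable (itg_sum s (fun p => i p)) => // y _ /=.
    by rewrite e.
  under eq_Rintegral do rewrite e.
  rewrite Rint_sum//; apply: eq_bigr => p _.
  by rewrite RintegralZl//; case: (gE p.2) => // _ ->.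
apply: (@Rint_fatou _ _ _ Q (fun n y => kfun k (s_ n) y / g y) _
  (fun n => 1 - (kfun k (s_ n) x - g x) ^+ 2 / 2)).
- by move=> n; apply: measurable_funM => //; exact: measurable_kfun.
- move=> n y; rewrite divr_ge0//; last exact: ltW.
  by apply: kfun_ge0 => //; apply/allP => p; exact: spos.
- by move=> y; apply: cvgM; [exact: sh|exact: cvg_cst].
- by move=> n; case: (fE (s_ n)).
- move=> n; have [_ ->] := fE (s_ n).
  have c1 : (fun m => \sum_(p <- s_ n) p.1 * kfun k (r_ m) p.2) @ \oo -->
      \sum_(p <- s_ n) p.1 * g p.2.
    elim: (s_ n) => [|p s IH].
      under eq_fun do rewrite big_nil.
      by rewrite big_nil; exact: cvg_cst.
    under eq_fun do rewrite big_cons.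
    rewrite big_cons; apply: cvgD => //.
    by apply: cvgM; [exact: cvg_cst|exact: rg].
  have c2 : (fun m => 1 - (kfun k (s_ n) x - kfun k (r_ m) x) ^+ 2 / 2) @ \oo -->
      1 - (kfun k (s_ n) x - g x) ^+ 2 / 2.
    apply: cvgB; first exact: cvg_cst.
    apply: cvgM; last exact: cvg_cst.
    by apply: cvgM; apply: cvgB; (exact: cvg_cst || exact: rg).
  apply: (ler_cvg_to c1 c2); apply: nearW => m.
  exact: kfun_dist.
apply: cvgB; first exact: cvg_cst.
apply: cvgM; last exact: cvg_cst.
by apply: cvgM; apply: cvgB; (exact: cvg_cst || exact: sh).
Qed.

End potential_pair.

(** * The Gaussian kernel on a Hilbert space *)

Section inner_product_theory.
Context (R : realType) (H : completeNormedModType R) (ip : H -> H -> R).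
Hypothesis hip : inner_product ip.
Implicit Types (x y z : H) (E : seq H).

Lemma ipC x y : ip x y = ip y x. Proof. by case: hip. Qed.
Lemma ipxx x : ip x x = `|x| ^+ 2. Proof. by case: hip. Qed.

Lemma ip0l z : ip 0 z = 0.
Proof. by case: hip => _ /(_ 1 0 0 z) + _; rewrite scaler0 addr0; lra. Qed.

Lemma ipDl x y z : ip (x + y) z = ip x z + ip y z.
Proof. by case: hip => _ /(_ 1 x y z) + _; rewrite scale1r mul1r. Qed.

Lemma ipZl a x z : ip (a *: x) z = a * ip x z.
Proof. by case: hip => _ /(_ a x 0 z) + _; rewrite addr0 ip0l addr0. Qed.

Lemma ipNl x z : ip (- x) z = - ip x z.
Proof. by rewrite -scaleN1r ipZl mulN1r. Qed.

Lemma ipBl x y z : ip (x - y) z = ip x z - ip y z.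
Proof. by rewrite ipDl ipNl. Qed.

Lemma ipBr x y z : ip z (x - y) = ip z x - ip z y.
Proof. by rewrite ipC ipBl !(ipC z). Qed.

Lemma ipZr a x z : ip z (a *: x) = a * ip z x.
Proof. by rewrite ipC ipZl (ipC z). Qed.

Lemma normB2 x y : `|x - y| ^+ 2 = `|x| ^+ 2 - 2 * ip x y + `|y| ^+ 2.
Proof. rewrite -!ipxx ipBl !ipBr (ipC y x); ring. Qed.

Lemma ip_CS x y : ip x y ^+ 2 <= `|x| ^+ 2 * `|y| ^+ 2.
Proof.
have [->|y0] := eqVneq y 0.
  by rewrite ipC ip0l normr0 !expr0n/= mulr0.
have yy : 0 < `|y| ^+ 2 by rewrite exprn_gt0// normr_gt0.
have := sqr_ge0 `| `|y| ^+ 2 *: x - ip x y *: y|.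
rewrite normB2 -!ipxx !ipZl !ipZr !ipxx.
set a := `|x| ^+ 2; set b := `|y| ^+ 2 in yy *; set c := ip x y => h.
have {}h : 0 <= b * (b * a - c ^+ 2) by lra.
by rewrite pmulr_rge0// subr_ge0 mulrC in h.
Qed.

Lemma ip_le_norm x y : `|ip x y| <= `|x| * `|y|.
Proof.
rewrite -(ler_pXn2r (n := 2))// ?nnegrE ?mulr_ge0//.
by rewrite real_normK ?num_real// exprMn ip_CS.
Qed.

Fixpoint orthonormal E := if E is e :: E' then
  [/\ ip e e = 1, forall f, f \in E' -> ip e f = 0 & orthonormal E'] else True.

Definition proj E x := \sum_(e <- E) ip x e *: e.

Lemma proj_cons e E x : proj (e :: E) x = ip x e *: e + proj E x.
Proof. by rewrite /proj big_cons. Qed.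

Lemma ip_proj E x y : ip (proj E x) y = \sum_(e <- E) ip x e * ip y e.
Proof.
elim: E => [|e E IH]; first by rewrite /proj !big_nil ip0l.
by rewrite proj_cons big_cons ipDl ipZl IH (ipC e).
Qed.

Lemma ip_proj_mem E x f : orthonormal E -> f \in E -> ip (proj E x) f = ip x f.
Proof.
elim: E => // e E IH [e1 eE oE]; rewrite proj_cons ipDl ipZl inE.
case/orP => [/eqP ->|fE]; last by rewrite eE// mulr0 add0r IH.
rewrite e1 mulr1 ip_proj big_seq big1 ?addr0// => g gE.
by rewrite eE// mulr0.
Qed.

Lemma proj_orth E x y : orthonormal E -> ip (x - proj E x) (proj E y) = 0.
Proof.
move=> oE; rewrite ipC ip_proj big_seq big1// => e eE.
by rewrite ipBl ip_proj_mem// subrr mulr0.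
Qed.

Lemma norm_proj E x : orthonormal E ->
  `|x| ^+ 2 = \sum_(e <- E) ip x e ^+ 2 + `|x - proj E x| ^+ 2.
Proof.
move=> oE.
have h : ip (x - proj E x) (proj E x) = 0 by exact: proj_orth.
have hs : ip (proj E x) x = \sum_(e <- E) ip x e ^+ 2 by rewrite ip_proj.
move: h; rewrite normB2 -!ipxx ipBl (ipC x) hs; lra.
Qed.

Lemma proj_min E x y : orthonormal E -> y = proj E y ->
  `|x - proj E x| ^+ 2 <= `|x - y| ^+ 2.
Proof.
move=> oE yE.
have -> : x - y = (x - proj E x) - (y - proj E x) by rewrite opprB addrA addrNK.
rewrite [leRHS]normB2.
have -> : ip (x - proj E x) (y - proj E x) = 0.
  have -> : y - proj E x = proj E y - proj E x by rewrite -yE.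
  by rewrite ipBr !proj_orth// subrr.
by rewrite mulr0 subr0 lerDl sqr_ge0.
Qed.

(** Vectors already in the span of the previous ones add nothing to [E], so [s] may be linearly
    dependent. *)
Lemma gram_schmidt (s : seq H) : exists E, orthonormal E /\
  forall x, x \in s -> x = proj E x.
Proof.
elim: s => [|x s [E [oE hE]]]; first by exists [::].
have [r0|r0] := eqVneq (x - proj E x) 0.
  exists E; split => // y; rewrite inE => /orP[/eqP ->|/hE//].
  by apply/eqP; rewrite -subr_eq0 r0.
set r := x - proj E x in r0.
have rr : ip r r != 0 by rewrite ipxx expf_eq0/= normr_eq0.
have nr : `|r| != 0 by rewrite normr_eq0.
have rE f : f \in E -> ip r f = 0 by move=> fE; rewrite ipBl ip_proj_mem// subrr.
have oE' : orthonormal (`|r|^-1 *: r :: E).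
  split => //; last by move=> f fE; rewrite ipZl rE// mulr0.
  by rewrite ipZl ipZr ipxx; field.
exists (`|r|^-1 *: r :: E); split => // y; rewrite inE => /orP[/eqP ->|/hE yE].
  rewrite proj_cons ipZr.
  have -> : ip x r = `|r| ^+ 2.
    have xr : x = r + proj E x by rewrite addrNK.
    transitivity (ip (r + proj E x) r); first by rewrite -xr.
    rewrite -ipxx ipDl ip_proj [X in _ + X]big_seq big1 ?addr0// => e eE.
    by rewrite rE// mulr0.
  rewrite expr2 mulrA mulVf// mul1r scalerA mulfV// scale1r.
  by rewrite addrNK.
rewrite proj_cons [X in X *: _](_ : _ = 0) ?scale0r ?add0r//.
rewrite yE ip_proj big_seq big1// => e eE.
by rewrite ipZl rE// !mulr0.
Qed.

(** Schur product by induction: one factor [ip x y] is expanded in an orthonormal family [E]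
    spanning the points, and each [e] contributes the quadratic form of degree [n] with weights
    multiplied by [ip x e]. *)
Lemma psd_kernel_ipX n : psd_kernel (fun x y => ip x y ^+ n).
Proof.
split => [x y|]; first by rewrite ipC.
elim: n => [|n IH] s.
  rewrite /kip /kfun; under eq_bigr do under eq_bigr do rewrite expr0 mulr1.
  by rewrite -mulr_suml -expr2 sqr_ge0.
have [E [oE hE]] := gram_schmidt [seq p.2 | p <- s].
rewrite [leRHS](_ : _ = \sum_(e <- E) kip (fun x y => ip x y ^+ n)
  [seq (p.1 * ip p.2 e, p.2) | p <- s] [seq (p.1 * ip p.2 e, p.2) | p <- s]).
  by apply: sumr_ge0.
rewrite /kip; under [RHS]eq_bigr do rewrite big_map.
rewrite exchange_big big_seq [RHS]big_seq; apply: eq_bigr => p ps.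
rewrite /kfun/=.
under [RHS]eq_bigr do rewrite big_map mulr_sumr.
rewrite exchange_big mulr_sumr; apply: eq_bigr => q _ /=.
rewrite exprS {1}(hE p.2) ?map_f// ip_proj mulr_suml !mulr_sumr.
by apply: eq_bigr => e _; ring.
Qed.

Lemma cvg_bigsum I (r : seq I) (f : nat -> I -> R) (l : I -> R) :
  (forall i, (fun n => f n i) @ \oo --> l i) ->
  (fun n => \sum_(i <- r) f n i) @ \oo --> \sum_(i <- r) l i.
Proof.
move=> h; elim: r => [|i r IH].
  under eq_fun do rewrite big_nil.
  by rewrite big_nil; exact: cvg_cst.
by under eq_fun do rewrite big_cons; rewrite big_cons; exact: cvgD.
Qed.

(** The partial sums of the exponential series are combinations of the power kernels with
    nonnegative coefficients, and positivity passes to the limit. *)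
Lemma psd_kernel_expip c : 0 <= c -> psd_kernel (fun x y => expR (c * ip x y)).
Proof.
move=> c0; split => [x y|s]; first by rewrite ipC.
have cv : (fun N => kip (fun x y => series (exp_coeff (c * ip x y)) N) s s) @ \oo
    --> kip (fun x y => expR (c * ip x y)) s s.
  apply: cvg_bigsum => p; apply: cvgM; first exact: cvg_cst.
  apply: cvg_bigsum => q; apply: cvgM; first exact: cvg_cst.
  exact: is_cvg_series_exp_coeff.
apply: (cvgr_to_ge cv); apply: nearW => N.
rewrite [leRHS](_ : _ = \sum_(0 <= n < N)
   (c ^+ n / n`!%:R) * kip (fun x y => ip x y ^+ n) s s).
  apply: sumr_ge0 => n _; rewrite mulr_ge0 ?(psd_kernel_ipX n).2//.
  by rewrite divr_ge0// exprn_ge0.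
under [RHS]eq_bigr do rewrite mulr_sumr.
rewrite exchange_big; apply: eq_bigr => p _ /=; rewrite /kfun.
under [RHS]eq_bigr do rewrite !mulr_sumr.
rewrite exchange_big mulr_sumr; apply: eq_bigr => q _ /=.
rewrite /series/= !mulr_sumr; apply: eq_bigr => n _.
rewrite /exp_coeff/= exprMn; ring.
Qed.

Definition gker (eps : R) x y := expR (- (`|x - y| ^+ 2 / eps)).

Lemma psd_kernel_gker eps : 0 < eps -> psd_kernel (gker eps).
Proof.
move=> e0; split => [x y|s]; first by rewrite /gker distrC.
pose a x := expR (- (`|x| ^+ 2 / eps)).
(* The factor [a] can be absorbed in the weights of the list. *)
have gE x y : gker eps x y = a x * a y * expR (2 / eps * ip x y).
  by rewrite -!expRD; congr expR; rewrite normB2; ring.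
have c0 : 0 <= 2 / eps by apply: divr_ge0 => //; exact: ltW.
have := (psd_kernel_expip c0).2 [seq (p.1 * a p.2, p.2) | p <- s].
set u := kip _ _ _; suff -> : kip (gker eps) s s = u by [].
rewrite /u /kip big_map.
apply: eq_bigr => p _; rewrite /kfun big_map/= !mulr_sumr.
apply: eq_bigr => q _ /=; rewrite gE; ring.
Qed.

End inner_product_theory.

(** * Borel measurability in a separable normed space *)

Section borel_space.
Context (R : realType) (H : completeNormedModType R).

Lemma continuous_borel (f : H -> R) : continuous f ->
  measurable_fun setT (f : borel H -> R).
Proof.
move=> cf; apply: (measurability _ (RGenOpens.measurableE R)).
move=> _ [_ [a [b ->] <-]]; rewrite setTI.
by apply: sub_sigma_algebra; apply: open_comp => //; exact: interval_open.
Qed.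

Lemma measurable_norm_dist (a : H) :
  measurable_fun setT ((fun x => `|x - a|) : borel H -> R).
Proof.
apply: continuous_borel => x; apply: cvg_norm; apply: cvgB => //; exact: cvg_cst.
Qed.

Hypothesis sepH : separable_space H.

Lemma dense_seq : exists dn : nat -> H, forall x e, 0 < e ->
  exists n, `|x - dn n| < e.
Proof.
have [D [cD clD]] := sepH.
have D0 : D !=set0.
  have : closure D (0 : H) by rewrite clD.
  move=> /(_ setT (@filterT _ _ _)) [x [Dx _]]; by exists x.
have [f hf] : exists f : nat -> H, forall x, D x -> exists n, f n = x.
  have [x0 Dx0] := D0.
  have /pfcard_geP[D00|[f]] : (D #<= [set: nat])%card by exact: cD.
    by move: Dx0; rewrite D00.
  exists f => x Dx; have [n _ <-] := @surj _ _ _ _ f x Dx; by exists n.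
exists f => x e e0.
have : closure D x by rewrite clD.
move=> /(_ (ball x e) (nbhsx_ballx x e e0)) [y [/hf[n <-]]].
by rewrite -ball_normE /ball_ /= => ?; exists n.
Qed.

(** The product here carries the product of the Borel sigma-algebras, so continuity on [H * H] is
    not directly usable. By density the distance is the infimum over [n] of [|x - d_n| + |y - d_n|],
    whose terms depend on one coordinate each. *)
Lemma measurable_dist :
  measurable_fun setT (fun z : borel H * borel H => `|(z.1 : H) - z.2|).
Proof.
have [dn hd] := dense_seq.
pose u n (z : borel H * borel H) := `|(z.1 : H) - dn n| + `|(z.2 : H) - dn n|.
rewrite (_ : (fun z => _) = fun z => infs (u ^~ z) 0%N).
  apply: measurable_fun_infs => [z _|n].
    by exists 0 => _ [n _ <-]; rewrite addr_ge0.
  apply: measurable_funD.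
    exact: (measurableT_comp (measurable_norm_dist (dn n)) measurable_fst).
  exact: (measurableT_comp (measurable_norm_dist (dn n)) measurable_snd).
apply/funext => z; apply/eqP; rewrite eq_le; apply/andP; split.
  apply: lb_le_inf; first by exists (u 0%N z); exists 0%N.
  move=> _ [n _ <-]; rewrite /u (distrC z.2).
  by rewrite (le_trans _ (ler_normD _ _))// addrA addrNK.
apply/ler_addgt0Pr => e e0.
have e4 : 0 < e / 2 by rewrite divr_gt0.
have [n hn] := hd z.1 _ e4.
apply: (le_trans (_ : _ <= u n z)).
  apply: ge_inf; last by exists n.
  by exists 0 => _ [m _ <-]; rewrite addr_ge0.
rewrite /u; have := ler_normD ((z.2 : H) - z.1) ((z.1 : H) - dn n).
rewrite addrA addrNK (distrC z.2 z.1) => h; lra.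
Qed.

End borel_space.

(** * Positivity of the Gaussian kernel on integrals *)

Section discretisation.
Context (R : realType) (H : completeNormedModType R) (ip : H -> H -> R).
Hypothesis hip : inner_product ip.
Variables (dn : nat -> H) (P : probability (borel H) R).
Hypothesis dnE : forall x e, 0 < e -> exists n, `|x - dn n| < e.

(** [nearest j] takes finitely many values, among [dn 0] to [dn j], and tends pointwise to the
    identity; it turns integrals into finite sums. *)
Fixpoint mindist j (x : H) : R := if j is j'.+1 then
  Num.min (mindist j' x) `|x - dn j| else `|x - dn 0|.
Fixpoint nearest j (x : H) : H := if j is j'.+1 then
  if `|x - dn j| < mindist j' x then dn j else nearest j' x else dn 0.

Lemma nearestE j x : `|x - nearest j x| = mindist j x.
Proof.
elim: j => //= j IH; rewrite minC.
by case: ltP => // h; rewrite IH.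
Qed.

Lemma mindist_le j i x : (i <= j)%N -> mindist j x <= `|x - dn i|.
Proof.
elim: j => [|j IH]; first by rewrite leqn0 => /eqP ->.
rewrite leq_eqVlt => /orP[/eqP ->|]; first by rewrite /= ge_min lexx orbT.
by rewrite ltnS => /IH h; rewrite /= ge_min h.
Qed.

Lemma cvg_nearest x : (fun j => nearest j x) @ \oo --> x.
Proof.
apply/cvgrPdist_lt => e e0; have [n hn] := dnE x e0.
exists n => // j /= nj; rewrite nearestE.
exact: le_lt_trans (mindist_le _ nj) hn.
Qed.

Lemma measurable_mindist j : measurable_fun setT (mindist j : borel H -> R).
Proof.
elim: j => [|j IH] /=; first exact: measurable_norm_dist.
by apply: measurable_minr => //; exact: measurable_norm_dist.
Qed.

(** The image of [w P] under [nearest j] is a finite sum of point masses, listed in [L]. Hence [L]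
    does not depend on [f], and [f] can be any function, measurable or not. The induction
    generalises [w]: the cell of the new point is split off and [w] is cut to its complement. *)
Lemma nearest_integral j (w : borel H -> R) (M : R) : measurable_fun setT w ->
  (forall x, 0 <= w x <= M) ->
  exists L : seq (R * H), forall f : H -> R,
    P.-integrable setT (EFin \o (fun y => f (nearest j y) * w y)) /\
    \int[P]_y (f (nearest j y) * w y) = \sum_(p <- L) p.1 * f p.2.
Proof.
elim: j w => [|j IH] w mw wM.
  have iw : P.-integrable setT (EFin \o w).
    apply: (@itg_bounded _ _ _ _ _ M) => // x.
    by have /andP[? ?] := wM x; rewrite ger0_norm.
  exists [:: (\int[P]_y w y, dn 0)] => f; split; first exact: (itgZ (f (dn 0)) iw).
  have -> : \int[P]_y (f (nearest 0 y) * w y) = \int[P]_y (f (dn 0) * w y) by [].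
  by rewrite RintegralZl// big_seq1/= mulrC.
pose A := [set x : borel H | `|(x : H) - dn j.+1| < mindist j x].
have mA : measurable A.
  have -> : A = setT `&` (fun x : borel H =>
      `|(x : H) - dn j.+1| < mindist j x) @^-1` [set true].
    by rewrite setTI; apply/seteqP; split => x /=; rewrite /A/=.
  apply: measurable_fun_ltr => //; first exact: measurable_norm_dist.
  exact: measurable_mindist.
have mI B : measurable B -> measurable_fun setT (\1_B : borel H -> R).
  by move=> mB; exact: measurable_indic.
have [||L hL] := IH (fun x => \1_(~` A) x * w x).
- by apply: measurable_funM => //; apply: mI; exact: measurableC.
- move=> x; have /andP[? ?] := wM x; rewrite indicE.
  have M0 : 0 <= M by exact: le_trans (_ : 0 <= w x) _.
  case: (x \in ~` A) => /=; last by rewrite mul0r lexx.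
  by rewrite mul1r; apply/andP.
- have i1 : P.-integrable setT (EFin \o (fun x => \1_A x * w x)).
    apply: (@itg_bounded _ _ _ _ _ M).
      by apply: measurable_funM => //; exact: mI.
    move=> x; have /andP[? ?] := wM x; rewrite indicE.
    case: (x \in A); rewrite ?mul1r ?mul0r ?normr0 ?ger0_norm//.
    exact: le_trans (_ : 0 <= w x) _.
  exists ((\int[P]_y (\1_A y * w y), dn j.+1) :: L) => f.
  have fE y : f (nearest j.+1 y) * w y =
      f (dn j.+1) * (\1_A y * w y) + f (nearest j y) * (\1_(~` A) y * w y).
    rewrite !indicE in_setC /=.
    have [yA|yA] := boolP (y \in A).
      by move: (yA); rewrite inE /A/= => ->; rewrite mul1r mul0r mulr0 addr0.
    rewrite mul0r mulr0 add0r mul1r; case: ifP => // h.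
    by case/negP: yA; rewrite inE.
  have [iL eL] := hL f.
  have i2 := itgZ (f (dn j.+1)) i1.
  split.
    by apply: eq_integrable (itgD i2 iL) => // y _; rewrite /comp fE.
  under eq_Rintegral do rewrite fE.
  by rewrite RintegralD// RintegralZl// eL big_cons/= mulrC.
Qed.

Variable eps : R.
Hypothesis eps0 : 0 < eps.
Local Notation k := (gker eps : H -> H -> R).

Lemma gker_gt0 (x y : H) : 0 < k x y. Proof. exact: expR_gt0. Qed.

Lemma gker_le1 (x y : H) : k x y <= 1.
Proof.
by rewrite -[leRHS]expR0 ler_expR oppr_le0 divr_ge0// ?sqr_ge0// ltW.
Qed.

Lemma gkerxx (x : H) : k x x = 1.
Proof. by rewrite /gker subrr normr0 expr0n/= mul0r oppr0 expR0. Qed.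

Lemma cvg_gker (u v : nat -> H) x y : u @ \oo --> x -> v @ \oo --> y ->
  (fun n => k (u n) (v n)) @ \oo --> k x y.
Proof.
move=> ux vy.
have h : (fun n => `|u n - v n|) @ \oo --> `|x - y|.
  by apply: cvg_norm; exact: cvgB.
have h2 : (fun n => - (`|u n - v n| ^+ 2 / eps)) @ \oo --> - (`|x - y| ^+ 2 / eps).
  by apply: cvgN; apply: cvgM; [exact: (cvgM h h)|exact: cvg_cst].
by apply: continuous_cvg h2; exact: continuous_expR.
Qed.

(** Positivity for the list [s - L j] is the inequality for the discretised integrals; dominated
    convergence lets [j] go to infinity, first in the inner integral and then in the outer one. *)
Lemma psd_integral_gker : psd_integral (k : borel H -> borel H -> R) P.
Proof.
move=> w M s mw wM.
have M0 : 0 <= M by have /andP[/le_trans] := wM 0; exact.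
have [kC kp] := psd_kernel_gker hip eps0.
have /choice[L hL] : forall j, exists L : seq (R * H), forall f : H -> R,
    P.-integrable setT (EFin \o (fun y => f (nearest j y) * w y)) /\
    \int[P]_y (f (nearest j y) * w y) = \sum_(p <- L) p.1 * f p.2.
  by move=> j; exact: nearest_integral mw wM.
have ineq j : 2 * \int[P]_y (kfun k s (nearest j y) * w y) <=
    kip k s s + \int[P]_x (w x *
       \int[P]_y (k (nearest j x) (nearest j y) * w y)).
  have := kp (s ++ lscale (-1) (L j)).
  rewrite kip_catl !kip_catr !kip_scalel !kip_scaler.
  rewrite (kipC (conj kC kp) s (L j)).
  have -> : kip k (L j) s = \int[P]_y (kfun k s (nearest j y) * w y).
    by have [_ ->] := hL j (kfun k s).
  have -> : kip k (L j) (L j) = \int[P]_x (w x *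
       \int[P]_y (k (nearest j x) (nearest j y) * w y)).
    have [_ e] := hL j (kfun k (L j)); rewrite -[LHS]e.
    apply: eq_Rintegral => x _; rewrite mulrC; congr (_ * _).
    by have [_ ->] := hL j (k (nearest j x)).
  lra.
have mf f j : measurable_fun setT (fun y : borel H => f (nearest j y) * w y).
  by have [/integrable_mfun] := hL j f.
have c1 : (fun j => \int[P]_y (kfun k s (nearest j y) * w y)) @ \oo -->
    \int[P]_y (kfun k s y * w y).
  pose C := \sum_(p <- s) `|p.1|.
  have kfun_le y : `|kfun k s y| <= C.
    apply: (le_trans (ler_norm_sum _ _ _)); apply: ler_sum => p _.
    by rewrite normrM ler_piMr// ger0_norm ?gker_le1// ltW// gker_gt0.
  have [] := @Rint_dct _ _ _ P (fun j y => kfun k s (nearest j y) * w y)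
    (fun y => kfun k s y * w y) (cst (C * M)).
  - by move=> n; exact: mf.
  - move=> y; apply: cvgM; last exact: cvg_cst.
    apply: cvg_bigsum => p; apply: cvgM; first exact: cvg_cst.
    by apply: cvg_gker; [exact: cvg_nearest|exact: cvg_cst].
  - exact: finite_measure_integrable_cst.
  - move=> j y /=; rewrite normrM; have /andP[? ?] := wM y.
    by rewrite ler_pM// ger0_norm.
  - by [].
have kw x y z : 0 <= k x y * w z <= M.
  have /andP[? ?] := wM z; rewrite mulr_ge0//=; last exact/ltW/gker_gt0.
  by rewrite -[leRHS]mul1r ler_pM// ?gker_le1//; exact/ltW/gker_gt0.
have inner x : (fun j => \int[P]_y (k (nearest j x) (nearest j y) * w y)) @ \oo
    --> \int[P]_y (k x y * w y).
  have [] := @Rint_dct _ _ _ P (fun j y => k (nearest j x) (nearest j y) * w y)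
    (fun y => k x y * w y) (cst M).
  - by move=> n; exact: mf.
  - move=> y; apply: cvgM; last exact: cvg_cst.
    by apply: cvg_gker; exact: cvg_nearest.
  - exact: finite_measure_integrable_cst.
  - by move=> j y /=; have /andP[? ?] := kw (nearest j x) (nearest j y) y; rewrite ger0_norm.
  - by [].
have inner_bd j x : 0 <= \int[P]_y (k (nearest j x) (nearest j y) * w y) <= M.
  have [i1 _] := hL j (k (nearest j x)).
  rewrite Rintegral_ge0//=; last first.
    move=> y _; have /andP[? ?] := wM y; rewrite mulr_ge0//.
    exact/ltW/gker_gt0.
  rewrite -[leRHS](Rint_prob_cst P); apply: le_Rintegral => //.
    exact: finite_measure_integrable_cst.
  move=> y _; have /andP[? ?] := wM y.
  by rewrite -[leRHS]mul1r ler_pM// ?gker_le1//; exact/ltW/gker_gt0.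
have c2 : (fun j => \int[P]_x (w x *
       \int[P]_y (k (nearest j x) (nearest j y) * w y))) @ \oo -->
    \int[P]_x (w x * \int[P]_y (k x y * w y)).
  have [] := @Rint_dct _ _ _ P (fun j x => w x * \int[P]_y (k (nearest j x) (nearest j y) * w y))
    (fun x => w x * \int[P]_y (k x y * w y)) (cst (M * M)).
  (* The inner integral is [kfun k (L j)] at [nearest j x], which settles its measurability in
     [x]. *)
  - move=> j; have := mf (kfun k (L j)) j; congr (measurable_fun _ _).
    apply/funext => x; rewrite mulrC; congr (_ * _).
    by have [_ ->] := hL j (k (nearest j x)).
  - by move=> x; apply: cvgM; [exact: cvg_cst|exact: inner].
  - exact: finite_measure_integrable_cst.
  - move=> j x /=; have /andP[? ?] := inner_bd j x; have /andP[? ?] := wM x.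
    by rewrite ger0_norm ?mulr_ge0// ler_pM.
  - by [].
have c1' : (fun j => 2 * \int[P]_y (kfun k s (nearest j y) * w y)) @ \oo -->
    2 * \int[P]_y (kfun k s y * w y).
  by apply: cvgM => //; exact: cvg_cst.
have c2' : (fun j => kip k s s + \int[P]_x (w x *
       \int[P]_y (k (nearest j x) (nearest j y) * w y))) @ \oo -->
    kip k s s + \int[P]_x (w x * \int[P]_y (k x y * w y)).
  by apply: cvgD => //; exact: cvg_cst.
by apply: (ler_cvg_to c1' c2'); exact: nearW.
Qed.

End discretisation.

(** * Densities and marginals *)

Section density.
Context d (T : measurableType d) (R : realType).
Variables (mu nu : {measure set T -> \bar R}) (p : T -> R).
Hypothesis mp : measurable_fun setT p.
Hypothesis p0 : forall x, 0 <= p x.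
Hypothesis nuE : forall A, measurable A -> nu A = (\int[mu]_(x in A) (p x)%:E)%E.

Import HBNNSimple.

Let density_nnsfun (h : {nnsfun T >-> R}) :
  (\int[nu]_x (h x)%:E = \int[mu]_x (h x * p x)%:E)%E.
Proof.
have mA y : measurable (h @^-1` [set y]) by exact: measurable_sfunP.
have y0 y : y \in range h -> 0 <= y by rewrite inE => -[t _ <-].
have h1 y x : 0 <= y * \1_(h @^-1` [set y]) x.
  exact: nnfun_muleindic_ge0.
have mi y : measurable_fun setT (fun x => y * \1_(h @^-1` [set y]) x).
  by apply: measurable_funM => //; exact: measurable_indic.
transitivity (\int[nu]_x (\sum_(y \in range h)
    (y * \1_(h @^-1` [set y]) x)%:E))%E.
  by apply: eq_integral => x _; rewrite fsumEFin// -fimfunE.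
rewrite ge0_integral_fsum//; last 2 first.
- by move=> y; apply/measurable_EFinP; exact: mi.
- by move=> y x _; rewrite lee_fin.
transitivity (\int[mu]_x (\sum_(y \in range h)
    (y * \1_(h @^-1` [set y]) x * p x)%:E))%E; last first.
  apply: eq_integral => x _.
  rewrite fsumEFin//; congr (_%:E); rewrite (fimfunE h x).
  by rewrite !fsbig_finite//= mulr_suml.
rewrite ge0_integral_fsum//; last 2 first.
- by move=> y; apply/measurable_EFinP; exact: measurable_funM.
- by move=> y x _; rewrite lee_fin mulr_ge0.
apply: eq_fsbigr => y /y0 yge0.
under eq_integral do rewrite EFinM.
have mI : measurable_fun setT (\1_(h @^-1` [set y]) : T -> R).
  exact: measurable_indic.
have mIE : measurable_fun setT (fun x => (\1_(h @^-1` [set y]) x : R)%:E).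
  exact/measurable_EFinP.
have IE0 x : setT x -> (0 <= (\1_(h @^-1` [set y]) x : R)%:E)%E.
  by rewrite lee_fin.
rewrite ge0_integralZl//.
rewrite integral_indic// setIT nuE// integral_mkcond.
under [RHS]eq_integral do rewrite -mulrA EFinM.
have mIp : measurable_fun setT (fun x => (\1_(h @^-1` [set y]) x * p x : R)%:E).
  by apply/measurable_EFinP; exact: measurable_funM.
have Ip0 x : setT x -> (0 <= (\1_(h @^-1` [set y]) x * p x : R)%:E)%E.
  by rewrite lee_fin mulr_ge0.
rewrite ge0_integralZl//.
congr (_ * _)%E; apply: eq_integral => x _.
rewrite patchE indicE; case: ifP => _; first by rewrite mul1r.
by rewrite mul0r.
Qed.

(** Simple functions, then monotone convergence on both sides. *)
Lemma ge0_integral_density (f : T -> R) : measurable_fun setT f ->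
  (forall x, 0 <= f x) ->
  (\int[nu]_x (f x)%:E = \int[mu]_x (f x * p x)%:E)%E.
Proof.
move=> mf f0; have mf' : measurable_fun setT (EFin \o f) by exact/measurable_EFinP.
pose h := nnsfun_approx measurableT mf'.
have cv x : (fun n => (h n x)%:E) @ \oo --> (f x)%:E.
  by apply: (cvg_nnsfun_approx measurableT mf') => // y _; rewrite lee_fin.
have nd x a b : (a <= b)%N -> h a x <= h b x.
  by move=> ab; exact/lefP/nd_nnsfun_approx.
have -> : (\int[nu]_x (f x)%:E = limn (fun n => \int[nu]_x (h n x)%:E))%E.
  rewrite -monotone_convergence//.
  - by apply: eq_integral => x _; apply/esym/cvg_lim.
  - by move=> n; exact/measurable_EFinP.
  - by move=> n x _; rewrite lee_fin.
  - by move=> x _ a b ab; rewrite lee_fin nd.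
have -> : (\int[mu]_x (f x * p x)%:E = limn (fun n => \int[mu]_x (h n x * p x)%:E))%E.
  rewrite -monotone_convergence//.
  - apply: eq_integral => x _; apply/esym/cvg_lim => //.
    under eq_fun do rewrite EFinM.
    by rewrite EFinM; exact: cvgeZr.
  - by move=> n; apply/measurable_EFinP/measurable_funM.
  - by move=> n x _; rewrite lee_fin mulr_ge0.
  - by move=> x _ a b ab; rewrite lee_fin ler_wpM2r// nd.
by under eq_fun do rewrite density_nnsfun.
Qed.

Let ge0_integrable_density (f : T -> R) : nu.-integrable setT (EFin \o f) ->
  (forall x, 0 <= f x) ->
  mu.-integrable setT (EFin \o (fun x => f x * p x)) /\
  \int[mu]_x (f x * p x) = \int[nu]_x f x.
Proof.
move=> fi f0; have mf := integrable_mfun fi.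
have e := ge0_integral_density mf f0.
have mfp : measurable_fun setT (fun x => f x * p x) by exact: measurable_funM.
split; last by rewrite /Rintegral e.
apply/integrableP; split; first exact/measurable_EFinP.
under eq_integral do rewrite /= ger0_norm ?mulr_ge0//.
rewrite -e; case/integrableP: fi => _; under eq_integral do rewrite /= ger0_norm//.
by [].
Qed.

Lemma integral_density (f : T -> R) : nu.-integrable setT (EFin \o f) ->
  mu.-integrable setT (EFin \o (fun x => f x * p x)) /\
  \int[mu]_x (f x * p x) = \int[nu]_x f x.
Proof.
move=> fi.
have [p1 p2] := ge0_integrable_density (integrable_funrpos measurableT fi)
  (fun x => funrpos_ge0 f x).
have [n1 n2] := ge0_integrable_density (integrable_funrneg measurableT fi)
  (fun x => funrneg_ge0 f x).
have fE x : f x = f^\+ x - f^\- x by rewrite -[in LHS](funrposBneg f).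
split.
  apply: eq_integrable (itgB p1 n1) => // x _.
  by rewrite /= -mulrBl -fE.
transitivity (\int[mu]_x (f^\+ x * p x - f^\- x * p x)).
  by apply: eq_Rintegral => x _; rewrite -mulrBl -fE.
rewrite RintegralB// p2 n2 -RintegralB//.
- by apply: eq_Rintegral => x _; rewrite -fE.
- exact: integrable_funrpos.
- exact: integrable_funrneg.
Qed.

End density.

Section density_probability.
Context d (T : measurableType d) (R : realType).
Variables (mu : {measure set T -> \bar R}) (p : T -> R).

(** The proofs are arguments of the set function so that the measure and probability structures can
    be attached to it. *)
Definition density_prob (mp : measurable_fun setT p) (p0 : forall x, 0 <= p x)
    (p1 : (\int[mu]_x (p x)%:E = 1)%E) : set T -> \bar R :=
  fun A => (\int[mu]_(x in A) (p x)%:E)%E.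

Variables (mp : measurable_fun setT p) (p0 : forall x, 0 <= p x)
    (p1 : (\int[mu]_x (p x)%:E = 1)%E).

Local Notation nu := (density_prob mp p0 p1).

Let nu0 : nu set0 = 0%E.
Proof. by rewrite /density_prob integral_set0. Qed.

Let nu_ge0 A : (0 <= nu A)%E.
Proof. by apply: integral_ge0 => x _; rewrite lee_fin. Qed.

Let nu_sigma_additive : semi_sigma_additive nu.
Proof.
move=> F mF tF mUF; rewrite /density_prob; apply: cvg_toP.
  apply: ereal_nondecreasing_is_cvgn => m n mn.
  apply: lee_sum_nneg_natr => // k _ _; exact: nu_ge0.
rewrite ge0_integral_bigcup//=.
- by apply: measurable_funTS; exact/measurable_EFinP.
- by move=> x _; rewrite lee_fin.
Qed.

HB.instance Definition _ := isMeasure.Build _ _ _ nu nu0 nu_ge0 nu_sigma_additive.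

Let nu_setT : nu setT = 1%E. Proof. exact: p1. Qed.

HB.instance Definition _ := @Measure_isProbability.Build _ _ R nu nu_setT.

Lemma exists_density_prob : exists pi : probability T R, forall A, measurable A ->
  pi A = (\int[mu]_(x in A) (p x)%:E)%E.
Proof. by exists nu. Qed.

End density_probability.

Section integral_comparison.
Context d (T : measurableType d) (R : realType).
Variable mu : {measure set T -> \bar R}.

(** Only the lower function is integrable: this is meant for [p ln p], whose integral may be
    infinite. *)
Lemma Rint_le_integral (f g : T -> R) : mu.-integrable setT (EFin \o g) ->
  measurable_fun setT f -> (forall x, g x <= f x) ->
  ((\int[mu]_x g x)%:E <= \int[mu]_x (f x)%:E)%E.
Proof.
move=> ig mf gf; rewrite EFin_Rint// integralE [leRHS]integralE.
have mg := integrable_mfun ig.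
have mfE : measurable_fun setT (EFin \o f) by exact/measurable_EFinP.
have mgE : measurable_fun setT (EFin \o g) by exact/measurable_EFinP.
have m1 := measurable_funepos mfE; have m2 := measurable_funepos mgE.
have m3 := measurable_funeneg mfE; have m4 := measurable_funeneg mgE.
apply: leeB; apply: ge0_le_integral => // x _.
- by apply: (@funepos_le _ _ setT) => [y _|]; rewrite ?inE//= lee_fin.
- by apply: (@funeneg_le _ _ setT) => [y _|]; rewrite ?inE//= lee_fin.
Qed.

End integral_comparison.

Section marginal.
Context d1 d2 (T : measurableType d1) (S : measurableType d2) (R : realType).
Variables (P : probability S R) (Q : probability T R) (phi : S -> T).
Hypothesis mphi : measurable_fun setT phi.
Hypothesis PQ : forall A, measurable A -> P (phi @^-1` A) = Q A.

Lemma ge0_integral_image (f : T -> R) : measurable_fun setT f ->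
  (forall x, 0 <= f x) ->
  (\int[P]_z (f (phi z))%:E = \int[Q]_x (f x)%:E)%E.
Proof.
move=> mf f0.
have -> : (\int[Q]_x (f x)%:E = \int[pushforward P phi]_x (f x)%:E)%E.
  by apply: eq_measure_integral => A mA _; exact/esym/PQ.
rewrite ge0_integral_pushforward//; first exact/measurable_EFinP.
by move=> x _; rewrite lee_fin.
Qed.

Lemma integral_image (f : T -> R) : Q.-integrable setT (EFin \o f) ->
  P.-integrable setT (EFin \o (f \o phi)) /\
  \int[P]_z f (phi z) = \int[Q]_x f x.
Proof.
move=> fi; have mf := integrable_mfun fi.
have key (g : T -> R) : Q.-integrable setT (EFin \o g) -> (forall x, 0 <= g x) ->
    P.-integrable setT (EFin \o (g \o phi)) /\
    \int[P]_z g (phi z) = \int[Q]_x g x.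
  move=> gi g0; have mg := integrable_mfun gi.
  have e := ge0_integral_image mg g0; split; last by rewrite /Rintegral e.
  apply/integrableP; split.
    by apply/measurable_EFinP; exact: measurableT_comp.
  under eq_integral do rewrite /= ger0_norm//.
  rewrite e; case/integrableP: gi => _; under eq_integral do rewrite /= ger0_norm//.
  by [].
have [p1 p2] := key _ (integrable_funrpos measurableT fi) (fun x => funrpos_ge0 f x).
have [n1 n2] := key _ (integrable_funrneg measurableT fi) (fun x => funrneg_ge0 f x).
have fE x : f x = f^\+ x - f^\- x by rewrite -[in LHS](funrposBneg f).
split.
  by apply: eq_integrable (itgB p1 n1) => // z _; rewrite /= -fE.
transitivity (\int[P]_z (f^\+ (phi z) - f^\- (phi z))).
  by apply: eq_Rintegral => x _; rewrite -fE.
rewrite RintegralB// p2 n2 -RintegralB//.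
- by apply: eq_Rintegral => x _; rewrite -fE.
- exact: integrable_funrpos.
- exact: integrable_funrneg.
Qed.

End marginal.

(** * Entropic transport *)

Section transport.
Context (R : realType) (H : completeNormedModType R) (ip : H -> H -> R).
Hypothesis hH : hilbert_space ip.
Variable eps : R.
Hypothesis eps0 : 0 < eps.

Local Notation T := (borel H).
Local Notation k := (gker eps : T -> T -> R).
Implicit Types P Q : probability T R.

Definition has_second_moment P :=
  P.-integrable setT (EFin \o (fun x : T => `|x : H| ^+ 2)).

Let hip : inner_product ip. Proof. by case: hH. Qed.
Let sepH : separable_space H. Proof. by case: hH. Qed.

Lemma norm_sqrB_le (x y : H) : `|x - y| ^+ 2 <= 2 * `|x| ^+ 2 + 2 * `|y| ^+ 2.
Proof.
have h : `|x - y| ^+ 2 <= (`|x| + `|y|) ^+ 2.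
  by rewrite lerXn2r// ?nnegrE ?addr_ge0// ler_normB.
have := sqr_ge0 (`|x| - `|y|); nra.
Qed.

Lemma good_gker : good_kernel k.
Proof.
split.
- exact: (psd_kernel_gker hip eps0).
- by move=> x y; exact: gker_gt0.
- by move=> x; exact: gkerxx.
- apply: (measurableT_comp (@measurable_expR R)); apply: measurable_funN.
  apply: measurable_funM => //; apply: measurable_funX; exact: measurable_dist.
Qed.

Lemma ln_gker (x y : H) : ln (gker eps x y) = - (`|x - y| ^+ 2 / eps).
Proof. by rewrite /gker expRK. Qed.

Lemma itg_dist2 P (x : H) : has_second_moment P ->
  P.-integrable setT (EFin \o (fun y : T => `|x - (y : H)| ^+ 2)).
Proof.
move=> mP; apply: (@itg_le _ _ _ _ _ (fun y : T => 2 * `|x| ^+ 2 + 2 * `|y : H| ^+ 2)).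
- apply: measurable_funX.
  under eq_fun do rewrite distrC; exact: measurable_norm_dist.
- by apply: itgD; [exact: finite_measure_integrable_cst|exact: itgZ].
- by move=> y; rewrite ger0_norm ?sqr_ge0// norm_sqrB_le.
Qed.

Let low P (x : H) := expR (- ((2 * `|x| ^+ 2 + 2 * \int[P]_y (`|y : H| ^+ 2)) / eps)).

(* Jensen, through the tangent line of [exp] at [- m]. *)
Let low_le P (x : H) : has_second_moment P -> low P x <= \int[P]_y gker eps x y.
Proof.
move=> mP; set m := (2 * `|x| ^+ 2 + 2 * \int[P]_y (`|y : H| ^+ 2)) / eps.
have i2 := itg_dist2 x mP.
have cst_i c : P.-integrable setT (EFin \o cst c) by exact: finite_measure_integrable_cst.
have iu : P.-integrable setT (EFin \o (fun y : T =>
    expR (- m) * (1 + m - eps^-1 * `|x - (y : H)| ^+ 2))).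
  apply: itgZ; apply: itgB; [exact: cst_i|exact: itgZ].
apply: (@le_trans _ _ (\int[P]_y (expR (- m) * (1 + m - eps^-1 * `|x - (y : H)| ^+ 2)))).
  rewrite RintegralZl//; last by apply: itgB; [exact: cst_i|exact: itgZ].
  rewrite RintegralB//; [|exact: cst_i|exact: itgZ].
  rewrite Rint_prob_cst RintegralZl// /low -/m -[leLHS]mulr1 ler_pM2l ?expR_gt0//.
  suff : eps^-1 * \int[P]_y (`|x - (y : H)| ^+ 2) <= m by lra.
  rewrite /m mulrC ler_pM2r ?invr_gt0//.
  apply: (@le_trans _ _ (\int[P]_y (2 * `|x| ^+ 2 + 2 * `|y : H| ^+ 2))).
    apply: le_Rintegral => //; last by move=> y _; exact: norm_sqrB_le.
    by apply: itgD; [exact: cst_i|exact: itgZ].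
  by rewrite RintegralD//; [rewrite Rint_prob_cst RintegralZl|exact: cst_i|exact: itgZ].
apply: le_Rintegral => //.
  apply: (@itg_k _ _ _ k) => //; exact: good_gker.
move=> y _; have -> : gker eps x y =
    expR (- m) * expR (m - eps^-1 * `|x - (y : H)| ^+ 2).
  rewrite -expRD /gker; congr expR; set u := `|_| ^+ 2; rewrite addrA addNr add0r mulrC.
  by rewrite mulrC.
rewrite ler_pM2l ?expR_gt0// -addrA; exact: expR_ge1Dx.
Qed.

Lemma gker_potential P : has_second_moment P -> exists h s_, is_potential k P h s_.
Proof.
move=> mP; have := @exists_potential _ T R k P (low P).
apply.
- exact: good_gker.
- move=> y; apply: eq_integrable (itgZ (- eps^-1) (itg_dist2 y mP)) => // x _.
  by rewrite /= ln_gker distrC; congr (_%:E); ring.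
- by move=> x; exact: expR_gt0.
- by move=> x; exact: low_le.
- have [dn hd] := dense_seq sepH; exact: (psd_integral_gker hip _ hd eps0).
- exact: (0 : H).
Qed.

(** Since [h <= 1], its equation gives [h(x) >= int k(x, y) dP(y)], so [ln h] lies between a
    quadratic function of the norm and 0. *)
Lemma potential_low P h s_ : has_second_moment P -> is_potential k P h s_ ->
  P.-integrable setT (EFin \o (fun x => ln (h x))).
Proof.
move=> mP [mh h01 hE _ _].
have h_low x : low P x <= h x.
  apply: (le_trans (low_le x mP)); have [i1 <-] := hE x.
  apply: le_Rintegral => //; first by apply: (@itg_k _ _ _ k) => //; exact: good_gker.
  move=> y _; have /andP[h0 h1] := h01 y.
  by rewrite ler_pdivlMr// ler_piMr// ltW// gker_gt0.
apply: (@itg_between _ _ _ _ (fun x : T => ln (low P x)) (cst 0)).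
- exact: measurableT_comp.
- have i : P.-integrable setT (EFin \o (fun x : T =>
     - eps^-1 * (2 * `|x : H| ^+ 2 + 2 * \int[P]_y (`|y : H| ^+ 2)))).
    by apply: itgZ; apply: itgD; [exact: itgZ|exact: finite_measure_integrable_cst].
  apply: eq_integrable i => // x _; rewrite /= /low expRK; congr (_%:E); ring.
- exact: finite_measure_integrable_cst.
move=> x; have /andP[h0 h1] := h01 x.
by rewrite ler_ln ?posrE ?expR_gt0// h_low ln_le0.
Qed.

Lemma young_ln (p s : R) : 0 <= p -> p * s - expR s + p <= p * ln p.
Proof.
rewrite le_eqVlt => /predU1P[<-|p0].
  by rewrite !mul0r addr0 sub0r oppr_le0 ltW// expR_gt0.
have h : ln (p / expR s) = ln p - s by rewrite ln_div ?posrE ?expR_gt0// expRK.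
(* The bound [ln z <= z - 1] at [z = e^s / p], to be multiplied by [p]. *)
have := @le_ln1Dx _ (expR s / p - 1).
rewrite addrCA subrr addr0 ln_div ?posrE ?expR_gt0// expRK.
have e0 : 0 < expR s / p by rewrite divr_gt0// expR_gt0.
move=> /(_ _)/(le_trans _) hh.
have {}hh : s - ln p <= expR s / p - 1 by apply: hh; lra.
have := ler_wpM2l (ltW p0) hh.
by rewrite !mulrBr mulr1 mulrCA mulfV ?gt_eqF// mulr1; lra.
Qed.

Section couple.
Variables (P Q : probability T R) (h g : T -> R) (s_ r_ : nat -> seq (R * T)).
Hypothesis mP : has_second_moment P.
Hypothesis mQ : has_second_moment Q.
Hypothesis hP : is_potential k P h s_.
Hypothesis gQ : is_potential k Q g r_.

Local Notation cost := (fun z : T * T => `|(z.1 : H) - z.2| ^+ 2).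

Let h0 x : 0 < h x. Proof. by case: hP => _ /(_ x)/andP[]. Qed.
Let g0 x : 0 < g x. Proof. by case: gQ => _ /(_ x)/andP[]. Qed.
Let mh : measurable_fun setT h. Proof. by case: hP. Qed.
Let mg : measurable_fun setT g. Proof. by case: gQ. Qed.

(** Relative to the product measure. For two different measures it need not have mass 1; it then
    serves only as a test function in the lower bound. *)
Definition plan_density (z : T * T) := gker eps z.1 z.2 / (h z.1 * g z.2).

Lemma plan_density_ge0 z : 0 <= plan_density z.
Proof. by rewrite divr_ge0// ltW ?mulr_gt0// gker_gt0. Qed.

Lemma measurable_cost : measurable_fun setT cost.
Proof. by apply: measurable_funX; exact: measurable_dist. Qed.

Lemma measurable_plan_density : measurable_fun setT plan_density.
Proof.
apply: measurable_funM; first by case: good_gker.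
apply: measurable_pos_inv; last by move=> z; exact: mulr_gt0.
apply: measurable_funM.
- exact: (measurableT_comp mh measurable_fst).
- exact: (measurableT_comp mg measurable_snd).
Qed.

Lemma ln_plan_density z : ln (plan_density z) =
  - (eps^-1 * cost z) - ln (h z.1) - ln (g z.2).
Proof.
rewrite /plan_density ln_div ?posrE ?mulr_gt0 ?gker_gt0//.
by rewrite lnM ?posrE// ln_gker; ring.
Qed.

Lemma coupling_itg_cost (pi : probability (T * T)%type R) : coupling P Q pi ->
  pi.-integrable setT (EFin \o cost).
Proof.
move=> [c1 c2].
have [i1 _] := integral_image (@measurable_fst _ _ T T) c1 mP.
have [i2 _] := integral_image (@measurable_snd _ _ T T) c2 mQ.
apply: (itg_le measurable_cost (itgD (itgZ 2 i1) (itgZ 2 i2))) => z.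
by rewrite ger0_norm ?sqr_ge0//= norm_sqrB_le.
Qed.

Lemma coupling_ln_density (pi : probability (T * T)%type R) : coupling P Q pi ->
  pi.-integrable setT (EFin \o (fun z => ln (plan_density z))) /\
  \int[pi]_z ln (plan_density z) = - (eps^-1 * \int[pi]_z cost z)
    - \int[P]_x ln (h x) - \int[Q]_x ln (g x).
Proof.
move=> cpi; have ic := coupling_itg_cost cpi; have [c1 c2] := cpi.
have [i1 e1] := integral_image (@measurable_fst _ _ T T) c1 (potential_low mP hP).
have [i2 e2] := integral_image (@measurable_snd _ _ T T) c2 (potential_low mQ gQ).
have i3 := itgN (itgZ eps^-1 ic).
have i4 := itgB i3 i1; have i5 := itgB i4 i2.
split; first by apply: eq_integrable i5 => // z _; rewrite /= ln_plan_density.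
under eq_Rintegral do rewrite ln_plan_density.
rewrite RintegralB// RintegralB// e1 e2 RintN; last exact: itgZ.
by rewrite RintegralZl.
Qed.

(** The integral in the first variable comes first: the equation of [h] makes it [h(y) / g(y)]. *)
Lemma plan_density_mass : Q.-integrable setT (EFin \o (fun y => h y / g y)) ->
  (\int[P \x Q]_z (plan_density z)%:E = (\int[Q]_y (h y / g y))%:E)%E.
Proof.
move=> ihg; rewrite fubini_tonelli2//; last 2 first.
- by apply/measurable_EFinP; exact: measurable_plan_density.
- by move=> z; rewrite lee_fin plan_density_ge0.
rewrite EFin_Rint//; apply: eq_integral => y _; rewrite /fubini_G.
have [_ _ hE _ _] := hP; have [iy <-] := hE y.
rewrite EFinM EFin_Rint// -ge0_integralZr//.
- apply: eq_integral => x _; rewrite -EFinM; congr (_%:E).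
  by rewrite /plan_density /gker /= distrC invfM mulrA.
- by case/integrableP: iy.
- by move=> x _; rewrite lee_fin divr_ge0// ltW// gker_gt0.
- by rewrite lee_fin invr_ge0 ltW.
Qed.

(** Weak duality with the potentials [- eps ln h] and [- eps ln g]. The logarithm of [plan_density]
    contains [- cost / eps], so the transport cost cancels and only marginal integrals remain. *)
Lemma OTeps_ge : Q.-integrable setT (EFin \o (fun y => h y / g y)) ->
  ((eps * (- (\int[P]_x ln (h x)) - (\int[Q]_x ln (g x)) + 1 -
     (\int[Q]_y (h y / g y))))%:E <= OTeps eps P Q)%E.
Proof.
move=> ihg; apply: le_ereal_inf_tmp => _ [pi cpi <-].
have ic := coupling_itg_cost cpi.
have [ild eld] := coupling_ln_density cpi.
set L1 := \int[P]_x _ in eld *; set M := \int[Q]_y (h y / g y).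
set L2 := \int[Q]_x _ in eld *; set C := \int[pi]_z (`|(z.1 : H) - z.2| ^+ 2) in eld.
have kl : (((- (eps^-1 * C) - L1 - L2) + 1 - M)%:E <= KL pi (P \x Q))%E.
  apply: le_ereal_inf_tmp => _ [p [mp p0 pE] <-].
  have [is_ es] := integral_density mp p0 pE ild.
  have [ip1 ep1] := integral_density mp p0 pE
    (finite_measure_integrable_cst pi (1 : R) measurableT).
  rewrite Rint_prob_cst in ep1.
  have iM : (P \x Q)%E.-integrable setT (EFin \o plan_density).
    apply/integrableP; split; first by apply/measurable_EFinP; exact: measurable_plan_density.
    under eq_integral do rewrite /= ger0_norm ?plan_density_ge0//.
    by rewrite plan_density_mass// ltry.
  have eM : \int[(P \x Q)%E]_z plan_density z = M.
    by rewrite /Rintegral plan_density_mass.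
  have i6 := itgD (itgB is_ iM) ip1.
  apply: (@le_trans _ _ (\int[(P \x Q)%E]_z (ln (plan_density z) * p z -
     plan_density z + cst 1 z * p z))%:E).
    rewrite RintegralD//; last exact: itgB.
    by rewrite RintegralB// es ep1 eM lee_fin eld; lra.
  apply: Rint_le_integral => //.
    apply: measurable_funM => //; exact: measurableT_comp.
  move=> z; rewrite /= mul1r mulrC.
  (* Integrated against the product, the three terms give the integral of [ln plan_density] under
     [pi], the mass [M], and the mass 1 of [pi]. *)
  have := young_ln (ln (plan_density z)) (p0 z); rewrite lnK ?posrE//.
  by rewrite divr_gt0 ?mulr_gt0// gker_gt0.
have -> : (\int[pi]_z (`|(z.1 : H) - z.2| ^+ 2)%:E = C%:E)%E by rewrite EFin_Rint.
apply: (@le_trans _ _ (C%:E + eps%:E * ((- (eps^-1 * C) - L1 - L2) + 1 - M)%:E)%E).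
  rewrite -EFinM -EFinD lee_fin !mulrDr !mulrN mulrA mulfV ?gt_eqF// mul1r.
  by rewrite mulr1; lra.
by rewrite leeD2l// lee_pmul2l.
Qed.

End couple.

Section self_couple.
Variables (P : probability T R) (h : T -> R) (s_ : nat -> seq (R * T)).
Hypothesis mP : has_second_moment P.
Hypothesis hP : is_potential k P h s_.

Let h0 x : 0 < h x. Proof. by case: hP => _ /(_ x)/andP[]. Qed.
Let mh : measurable_fun setT h. Proof. by case: hP. Qed.

Let hh1 : (fun y => h y / h y) = cst 1.
Proof. by apply/funext => y; rewrite mulfV ?gt_eqF. Qed.

Local Notation p := (plan_density h h).

Let p_sym x y : p (x, y) = p (y, x).
Proof. by rewrite /plan_density /gker/= distrC mulrC (mulrC (h y)) mulrC. Qed.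

Lemma plan_density_marginal x : (\int[P]_y (p (x, y))%:E = 1)%E.
Proof.
have [_ _ hE _ _] := hP; have [ix ex] := hE x.
have h1 : (h x)^-1 * \int[P]_y (gker eps x y / h y) = 1.
  by rewrite ex mulVf ?gt_eqF.
rewrite -[RHS]/(1%:E) -h1 EFinM EFin_Rint// -ge0_integralZl//.
- apply: eq_integral => y _; rewrite -EFinM; congr (_%:E).
  by rewrite /plan_density /= invfM; ring.
- by case/integrableP: ix.
- by move=> y _; rewrite lee_fin divr_ge0// ltW// gker_gt0.
- by rewrite lee_fin invr_ge0 ltW.
Qed.

Lemma plan_coupling : exists pi, coupling P P pi /\
  (forall A, measurable A -> pi A = (\int[P \x P]_(z in A) (p z)%:E)%E).
Proof.
have mp := measurable_plan_density hP hP.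
have p0 := plan_density_ge0 hP hP.
have p1 : (\int[P \x P]_z (p z)%:E = 1)%E.
  rewrite (plan_density_mass hP hP) hh1 ?Rint_prob_cst//.
  exact: finite_measure_integrable_cst.
have [pi piE] := exists_density_prob mp p0 p1.
have mpE : measurable_fun setT (EFin \o p) by exact/measurable_EFinP.
have restr (B : set (T * T)) : measurable B ->
   pi B = (\int[P \x P]_z (p z * \1_B z)%:E)%E.
  move=> mB; rewrite piE// integral_mkcond; apply: eq_integral => z _.
  rewrite patchE indicE; case: ifP => _; by rewrite ?mulr1 ?mulr0.
have mpI (B : set (T * T)) : measurable B ->
    measurable_fun setT (fun z => (p z * \1_B z)%:E).
  move=> mB; apply/measurable_EFinP; apply: measurable_funM => //.
have pI0 (B : set (T * T)) z : (0 <= (p z * \1_B z)%:E)%E by rewrite lee_fin mulr_ge0.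
have mfst (A : set T) : measurable A -> measurable (@fst T T @^-1` A).
  by move=> mA; rewrite -[X in measurable X]setTI; exact: measurable_fst.
have msnd (A : set T) : measurable A -> measurable (@snd T T @^-1` A).
  by move=> mA; rewrite -[X in measurable X]setTI; exact: measurable_snd.
have fin (A : set T) : measurable A -> (\int[P]_x (\1_A x)%:E = P A)%E.
  by move=> mA; rewrite integral_indic// setIT.
have inner x (c : R) : 0 <= c -> (\int[P]_y (p (x, y) * c)%:E = c%:E)%E.
  move=> c0; under eq_integral do rewrite EFinM.
  rewrite ge0_integralZr// ?plan_density_marginal ?mul1e//.
  - exact: (measurableT_comp mpE (pair1_measurable x)).
  - by move=> y _; rewrite lee_fin.
exists pi; split; last exact: piE; split => A mA.
- rewrite restr; last exact: mfst.
  rewrite fubini_tonelli1; [|exact: (mpI _ (mfst _ mA))|exact: pI0].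
  rewrite -fin//; apply: eq_integral => x _; rewrite /fubini_F/=.
  have e y : p (x, y) * \1_(fst @^-1` A) (x, y) = p (x, y) * \1_A x by [].
  by under eq_integral do rewrite e; rewrite inner.
- rewrite restr; last exact: msnd.
  rewrite fubini_tonelli2; [|exact: (mpI _ (msnd _ mA))|exact: pI0].
  rewrite -fin//; apply: eq_integral => y _; rewrite /fubini_G/=.
  have e x : p (x, y) * \1_(snd @^-1` A) (x, y) = p (y, x) * \1_A y.
    by rewrite p_sym.
  by under eq_integral do rewrite e; rewrite inner.
Qed.

(** For [g = h] the plan has mass 1 and is admissible, and Young's inequality is an equality at its
    density, so the lower bound is attained. *)
Lemma OTeps_self : OTeps eps P P = (2 * (eps * - \int[P]_x ln (h x)))%:E.
Proof.
have ihh : P.-integrable setT (EFin \o (fun y => h y / h y)).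
  by rewrite hh1; exact: finite_measure_integrable_cst.
apply/eqP; rewrite eq_le; apply/andP; split; last first.
  apply: le_trans (OTeps_ge mP mP hP hP ihh).
  by rewrite hh1 Rint_prob_cst lee_fin; lra.
have [pi [cpi piE]] := plan_coupling.
have mp := measurable_plan_density hP hP.
have p0 := plan_density_ge0 hP hP.
have ic := coupling_itg_cost mP mP cpi.
have [ild eld] := coupling_ln_density mP mP hP hP cpi.
have [i1 e1] := integral_density mp p0 piE ild.
apply: (@le_trans _ _ (\int[pi]_z (`|(z.1 : H) - z.2| ^+ 2)%:E +
   eps%:E * \int[P \x P]_z (p z * ln (p z))%:E)%E).
  apply: (@le_trans _ _ (\int[pi]_z (`|(z.1 : H) - z.2| ^+ 2)%:E +
     eps%:E * KL pi (P \x P))%E).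
    by apply: ereal_inf_lbound; exists pi.
  apply: leeD2l; apply: lee_wpmul2l; first by rewrite lee_fin ltW.
  by apply: ereal_inf_lbound; exists p.
have -> : (\int[P \x P]_z (p z * ln (p z))%:E = (\int[pi]_z ln (p z))%:E)%E.
  rewrite -e1 EFin_Rint//; apply: eq_integral => z _.
  by rewrite mulrC.
rewrite -EFin_Rint// -EFinM -EFinD lee_fin eld.
by rewrite !mulrDr !mulrN mulrA mulfV ?gt_eqF// mul1r; lra.
Qed.

End self_couple.

End transport.

(** * Laplace transforms *)

Section smooth_step.
Variable R : realType.
Implicit Types x y : R.

(** The cubic fixing 0, 1/2 and 1 with zero derivative at 0 and 1. *)
Definition smoothstep : {poly R} := 3%:P * 'X^2 - 2%:P * 'X^3.

Lemma smoothstepE x : smoothstep.[x] = 3 * x ^+ 2 - 2 * x ^+ 3.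
Proof. by rewrite /smoothstep !hornerE. Qed.

Lemma smoothstep01 x : 0 <= x <= 1 -> 0 <= smoothstep.[x] <= 1.
Proof.
move=> /andP[x0 x1]; rewrite smoothstepE; apply/andP; split.
  have -> : 3 * x ^+ 2 - 2 * x ^+ 3 = x ^+ 2 * (3 - 2 * x) by ring.
  by rewrite mulr_ge0 ?sqr_ge0//; lra.
rewrite -subr_ge0.
have -> : 1 - (3 * x ^+ 2 - 2 * x ^+ 3) = (1 - x) ^+ 2 * (1 + 2 * x) by ring.
by rewrite mulr_ge0 ?sqr_ge0//; lra.
Qed.

Lemma smoothstep_sym x : smoothstep.[1 - x] = 1 - smoothstep.[x].
Proof. rewrite !smoothstepE; ring. Qed.

Local Notation it n x := (iter n (horner smoothstep) x).

Lemma iter_smoothstep01 n x : 0 <= x <= 1 -> 0 <= it n x <= 1.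
Proof. by move=> x01; elim: n => //= n IH; exact: smoothstep01. Qed.

Lemma iter_smoothstep_lt x : 0 <= x < 2^-1 ->
  (fun n => it n x) @ \oo --> 0.
Proof.
(* [r] is the contraction factor of the first step; as [y (3 - 2 y)] increases on [[0, 1/2]], it
   serves for all later iterates, and [r < 1] amounts to [(1 - 2 x) (1 - x) > 0]. *)
move=> /andP[x0 x1]; pose r := x * (3 - 2 * x).
have r0 : 0 <= r by rewrite mulr_ge0//; lra.
have r1 : r < 1 by rewrite /r; nra.
have h n : 0 <= it n x <= r ^+ n * x.
  elim: n => [|n /andP[h1 h2]] /=; first by rewrite expr0 mul1r x0 lexx.
  have yx : it n x <= x.
    by apply: (le_trans h2); rewrite ler_piMl// exprn_ile1// ltW.
  have hit : 0 <= it n x <= 1 by rewrite iter_smoothstep01// x0/=; lra.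
  rewrite (proj1 (andP (smoothstep01 hit)))/= exprS -mulrA.
  apply: (@le_trans _ _ (r * it n x)); last by rewrite ler_wpM2l.
  rewrite smoothstepE /r; set y := it n x in h1 yx *.
  have -> : 3 * y ^+ 2 - 2 * y ^+ 3 = y * (3 - 2 * y) * y by ring.
  rewrite ler_wpM2r//; nra.
apply: (@squeeze_cvgr _ _ _ _ (cst 0) (fun n => r ^+ n * x)).
- by apply: nearW => n; exact: h.
- exact: cvg_cst.
- rewrite -(mul0r x); apply: cvgM; last exact: cvg_cst.
  by apply: cvg_expr; rewrite ger0_norm.
Qed.

Lemma iter_smoothstep_half n : it n (2^-1) = 2^-1.
Proof. by elim: n => //= n ->; rewrite smoothstepE; lra. Qed.

Lemma iter_smoothstep_gt x : 2^-1 < x <= 1 -> (fun n => it n x) @ \oo --> (1 : R).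
Proof.
move=> /andP[x0 x1].
have e n : it n x = 1 - it n (1 - x).
  by elim: n => [|n IH] /=; [ring|rewrite IH smoothstep_sym].
have -> : (fun n => it n x) = (fun n => 1 - it n (1 - x)) by exact/funext.
suff : (fun n => 1 - it n (1 - x)) @ \oo --> (1 - 0 : R) by rewrite subr0.
apply: cvgB; first exact: cvg_cst.
by apply: iter_smoothstep_lt; apply/andP; split; lra.
Qed.

(* The iterates of [smoothstep] drive [0, 1/2[ to 0 and ]1/2, 1] to 1 and fix 1/2;
   [2 v^2 - v] sends the limits 0, 1/2, 1 to 0, 0, 1. *)
Definition step_poly (c : R) n : {poly R} :=
  (2%:P * 'X^2 - 'X) \Po
  iter n (fun p => smoothstep \Po p) ((4^-1)%:P * ('X - c%:P) + (2^-1)%:P).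

Lemma step_polyE c n x : (step_poly c n).[x] =
  let v := it n (4^-1 * (x - c) + 2^-1) in 2 * v ^+ 2 - v.
Proof.
rewrite /step_poly horner_comp !hornerE/=.
suff -> : (iter n (fun p => smoothstep \Po p)
  ((4^-1)%:P * ('X - c%:P) + (2^-1)%:P)).[x] = it n (4^-1 * (x - c) + 2^-1) by [].
elim: n => [|n IH] /=; first by rewrite !hornerE.
by rewrite horner_comp IH.
Qed.

Lemma step_poly_le1 c n x : -1 <= c <= 1 -> -1 <= x <= 1 ->
  `|(step_poly c n).[x]| <= 1.
Proof.
move=> /andP[c1 c2] /andP[x1 x2]; rewrite step_polyE/=.
(* [x - c] ranges over [[-2, 2]]; the affine map sends that interval to [[0, 1]] and the threshold
   [c] to the fixed point 1/2. *)
have /(iter_smoothstep01 n) : 0 <= 4^-1 * (x - c) + 2^-1 <= 1.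
  by apply/andP; split; lra.
set v := it n _ => /andP[v0 v1]; rewrite ler_norml; apply/andP; split; nra.
Qed.

Lemma cvg_step_poly c x : -1 <= c <= 1 -> -1 <= x <= 1 ->
  (fun n => (step_poly c n).[x]) @ \oo --> ((c < x)%R%:R : R).
Proof.
move=> /andP[c1 c2] /andP[x1 x2].
have -> : (fun n => (step_poly c n).[x]) = (fun n =>
    2 * it n (4^-1 * (x - c) + 2^-1) ^+ 2 - it n (4^-1 * (x - c) + 2^-1)).
  by apply/funext => n; rewrite step_polyE.
have key (l : R) : (fun n => it n (4^-1 * (x - c) + 2^-1)) @ \oo --> l ->
    2 * l ^+ 2 - l = (c < x)%R%:R ->
    (fun n => 2 * it n (4^-1 * (x - c) + 2^-1) ^+ 2 -
       it n (4^-1 * (x - c) + 2^-1)) @ \oo --> ((c < x)%R%:R : R).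
  move=> h <-; apply: cvgB => //; apply: cvgM; first exact: cvg_cst.
  exact: (cvgM h h).
move: key; case: (ltgtP c x) => [xc|xc|<-] key.
- apply: (key 1); last by rewrite /=; ring.
  by apply: iter_smoothstep_gt; apply/andP; split; lra.
- apply: (key 0); last by rewrite /=; ring.
  by apply: iter_smoothstep_lt; apply/andP; split; lra.
- apply: (key 2^-1); last by rewrite /=; lra.
  have -> : (fun n => it n (4^-1 * (c - c) + 2^-1)) = (fun=> 2^-1).
    by apply/funext => n; rewrite subrr mulr0 add0r iter_smoothstep_half.
  exact: cvg_cst.
Qed.

End smooth_step.

Section exp_bounds.
Variable R : realType.
Implicit Types u x : R.

Lemma expR_diff_bounds u : u <= expR u - 1 <= u * expR u.
Proof.
apply/andP; split; first by have := expR_ge1Dx u; lra.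
have := expR_ge1Dx (- u); rewrite expRN => h.
have := ler_wpM2r (ltW (expR_gt0 u)) h.
by rewrite mulVf ?gt_eqF ?expR_gt0//; lra.
Qed.

Lemma expR_diff_norm u : `|expR u - 1| <= `|u| * expR `|u|.
Proof.
have /andP[h1 h2] := expR_diff_bounds u.
have h3 : expR u <= expR `|u| by rewrite ler_expR ler_norm.
have e1 : 1 <= expR `|u| by have := expR_ge1Dx `|u|; have := normr_ge0 u; lra.
rewrite ler_norml; apply/andP; split.
  apply: le_trans h1; rewrite lerNl.
  apply: (@le_trans _ _ `|u|); first by rewrite -normrN ler_norm.
  by rewrite ler_peMr.
apply: (le_trans h2); apply: (@le_trans _ _ (`|u| * expR u)).
  by rewrite ler_wpM2r ?ler_norm// ltW// expR_gt0.
by rewrite ler_wpM2l.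
Qed.

(** Converts bounds in [|x|] into exponentials that are integrable by hypothesis. *)
Lemma expR_norm_le x : expR `|x| <= expR x + expR (- x).
Proof.
have [x0|x0] := lerP 0 x; first by rewrite (ger0_norm x0) lerDl expR_ge0.
by rewrite (ltr0_norm x0) lerDr expR_ge0.
Qed.

Lemma cvg_expR_quotient x :
  (fun n => (expR (n.+1%:R^-1 * x) - 1) / n.+1%:R^-1) @ \oo --> x.
Proof.
apply: (@squeeze_cvgr _ _ _ _ (cst x) (fun n => x * expR (n.+1%:R^-1 * x))).
- apply: nearW => n /=; have /andP[h1 h2] := expR_diff_bounds (n.+1%:R^-1 * x).
  have n0 : (0 : R) < n.+1%:R^-1 by rewrite invr_gt0.
  rewrite ler_pdivlMr// mulrC h1/= ler_pdivrMr//.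
  by apply: (le_trans h2); rewrite -mulrA mulrC.
- exact: cvg_cst.
- rewrite -[X in _ --> X]mulr1; apply: cvgM; first exact: cvg_cst.
  have h : (fun n => n.+1%:R^-1 * x) @ \oo --> (0 * x : R).
    by apply: cvgM; [exact: cvg_inv_nat|exact: cvg_cst].
  rewrite mul0r in h.
  have e : (fun n => expR (n.+1%:R^-1 * x)) @ \oo --> (expR 0 : R).
    by apply: continuous_cvg h; exact: continuous_expR.
  by rewrite expR0 in e.
Qed.

(** A majorant independent of [n], for dominated convergence. *)
Lemma expR_quotient_le n x :
  `|(expR (n.+1%:R^-1 * x) - 1) / n.+1%:R^-1| <= expR (2 * `|x|).
Proof.
have n0 : (0 : R) < n.+1%:R^-1 by rewrite invr_gt0.
have n1 : n.+1%:R^-1 <= (1 : R) by rewrite invf_le1// ler1n.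
have n0' : (0 : R) <= n.+1%:R^-1^-1 by rewrite invrK.
rewrite normrM (ger0_norm n0').
rewrite ler_pdivrMr//; apply: (le_trans (expR_diff_norm _)).
rewrite normrM (gtr0_norm n0) [leRHS]mulrC -mulrA ler_pM2l//.
have -> : 2 * `|x| = `|x| + `|x| by ring.
rewrite expRD ler_pM ?expR_ge0//.
  by have := expR_ge1Dx `|x|; lra.
by rewrite ler_expR ler_piMl.
Qed.

Lemma series_exp_coeff_le x n : 0 <= x -> series (exp_coeff x) n <= expR x.
Proof.
move=> x0; have := @is_cvg_series_exp_coeff R x.
move=> /(nondecreasing_cvgn_le _); apply.
by apply: nondecreasing_series => i _ _; rewrite /exp_coeff/= divr_ge0// exprn_ge0.
Qed.

Lemma series_cos_coeff_le x n : `|series (cos_coeff x) n| <= expR `|x|.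
Proof.
apply: le_trans (series_exp_coeff_le n (normr_ge0 x)).
rewrite /series/=; apply: (le_trans (ler_norm_sum _ _ _)); apply: ler_sum => i _.
rewrite /cos_coeff /exp_coeff/= -mulrA normrM -[leRHS]mul1r; apply: ler_pM => //.
  rewrite normrM -exprnP normrX normrN1 expr1n mulr1.
  by case: (odd i) => /=; rewrite ?normr0 ?normr1.
by rewrite normrM normfV normrX (ger0_norm (ler0n _ _)).
Qed.

Lemma series_sin_coeff_le x n : `|series (sin_coeff x) n| <= expR `|x|.
Proof.
apply: le_trans (series_exp_coeff_le n (normr_ge0 x)).
rewrite /series/=; apply: (le_trans (ler_norm_sum _ _ _)); apply: ler_sum => i _.
rewrite /sin_coeff /exp_coeff/= -mulrA normrM -[leRHS]mul1r; apply: ler_pM => //.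
  rewrite normrM normrX normrN1 expr1n mulr1.
  by case: (odd i) => /=; rewrite ?normr0 ?normr1.
by rewrite normrM normfV normrX (ger0_norm (ler0n _ _)).
Qed.

End exp_bounds.

Lemma series_cos_coeffE (R : realType) (x : R) m :
  series (cos_coeff x) m = \sum_(0 <= i < m) cos_coeff 1 i * x ^+ i.
Proof.
apply: eq_bigr => i _; by rewrite /cos_coeff/= expr1n mulr1 mulrAC.
Qed.

Lemma series_sin_coeffE (R : realType) (x : R) m :
  series (sin_coeff x) m = \sum_(0 <= i < m) sin_coeff 1 i * x ^+ i.
Proof.
apply: eq_bigr => i _; by rewrite /sin_coeff/= expr1n mulr1 mulrAC.
Qed.

Lemma cvg_cos_series (R : realType) (x : R) : series (cos_coeff x) @ \oo --> cos x.
Proof. by rewrite unlock; exact: is_cvg_series_cos_coeff. Qed.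

Lemma cvg_sin_series (R : realType) (x : R) : series (sin_coeff x) @ \oo --> sin x.
Proof. by rewrite unlock; exact: is_cvg_series_sin_coeff. Qed.

(** * Functions with the same integral under two probabilities *)

Section agreement.
Context d (T : measurableType d) (R : realType) (P Q : probability T R).
Implicit Types f g : T -> R.

Definition agree f := [/\ P.-integrable setT (EFin \o f),
  Q.-integrable setT (EFin \o f) & \int[P]_x f x = \int[Q]_x f x].

Lemma agree_mfun f : agree f -> measurable_fun setT f.
Proof. by case=> /integrable_mfun. Qed.

Lemma agreeZ c f : agree f -> agree (fun x => c * f x).
Proof. by case=> p q e; split; [exact: itgZ|exact: itgZ|rewrite !RintegralZl// e]. Qed.

Lemma agreeD f g : agree f -> agree g -> agree (fun x => f x + g x).
Proof.
move=> [p q e] [p' q' e']; split; [exact: itgD|exact: itgD|].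
by rewrite !RintegralD// e e'.
Qed.

Lemma agree_eq f g : f =1 g -> agree f -> agree g.
Proof. by move=> /funext ->. Qed.

Lemma agree0 : agree (fun=> 0).
Proof. by split; rewrite ?Rint_prob_cst//; exact: finite_measure_integrable_cst. Qed.

Lemma agree_sum I (s : seq I) (F : I -> T -> R) : (forall i, agree (F i)) ->
  agree (fun x => \sum_(i <- s) F i x).
Proof.
move=> h; elim: s => [|i s IH].
  by apply: agree_eq agree0 => x; rewrite big_nil.
by apply: agree_eq (agreeD (h i) IH) => x; rewrite big_cons.
Qed.

Lemma agree_dct (f_ : nat -> T -> R) f g : (forall n, agree (f_ n)) ->
  (forall x, f_ ^~ x @ \oo --> f x) -> agree g ->
  (forall n x, `|f_ n x| <= g x) -> agree f.
Proof.
move=> af cf [gp gq _] fg.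
have [p1 p2] := Rint_dct (fun n => agree_mfun (af n)) cf gp fg.
have [q1 q2] := Rint_dct (fun n => agree_mfun (af n)) cf gq fg.
split => //.
have e : (fun n => \int[P]_x f_ n x) = fun n => \int[Q]_x f_ n x.
  by apply/funext => n; case: (af n).
rewrite e in p2; exact: (cvg_unique _ p2 q2).
Qed.

(* Difference quotients at [t = 0] give the moments of [th], Taylor series give
   [cos (t th)] and [sin (t th)], polynomials in a cosine give indicators of
   periodic unions of intervals, and large periods leave a single interval. *)
Section tilt.
Variables (W th : T -> R).
Hypothesis W0 : forall x, 0 <= W x.
Hypothesis tilt : forall t, agree (fun x => W x * expR (t * th x)).

(** One more factor is a difference of the tilts by [t + dl] and by [t]; hence the induction keeps
    [t] free. *)
Let agree_quotient n (dl t : R) : agree (fun x =>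
  W x * expR (t * th x) * ((expR (dl * th x) - 1) / dl) ^+ n).
Proof.
elim: n t => [|n IH] t.
  by apply: agree_eq (tilt t) => x; rewrite expr0 mulr1.
apply: agree_eq (agreeD (agreeZ dl^-1 (IH (t + dl))) (agreeZ (- dl^-1) (IH t))) => x.
by rewrite exprS mulrDl expRD; ring.
Qed.

Let bound t : agree (fun x => W x * (expR (t * th x) + expR (- (t * th x)))).
Proof.
apply: agree_eq (agreeD (tilt t) (tilt (- t))) => x.
by rewrite mulNr mulrDr.
Qed.

Let agree_power n : agree (fun x => W x * th x ^+ n).
Proof.
(* The majorant is the [n]-th power of [exp (2 |th|)], whence the exponent [n * 2]. *)
apply: (@agree_dct (fun m x => W x * ((expR (m.+1%:R^-1 * th x) - 1) / m.+1%:R^-1) ^+ n)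
  _ _ _ _ (bound (n%:R * 2))).
- move=> m; apply: agree_eq (agree_quotient n m.+1%:R^-1 0) => x.
  by rewrite mul0r expR0 mulr1.
- move=> x; apply: cvgM; first exact: cvg_cst.
  elim: n => [|n IH]; first by under eq_fun do rewrite expr0; exact: cvg_cst.
  under eq_fun do rewrite exprS; rewrite exprS; apply: cvgM => //.
  exact: cvg_expR_quotient.
- move=> m x; rewrite normrM (ger0_norm (W0 x)) ler_wpM2l// normrX.
  apply: (le_trans (lerXn2r n _ _ (expR_quotient_le m (th x)))); rewrite ?nnegrE ?expR_ge0//.
  apply: le_trans (expR_norm_le _).
  by rewrite -expRM_natl ler_expR mulrA normrM (ger0_norm (_ : 0 <= n%:R * 2))// mulr_ge0.
Qed.

Let agree_power_sum m (c : nat -> R) t :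
  agree (fun x => W x * \sum_(0 <= i < m) c i * (t * th x) ^+ i).
Proof.
apply: agree_eq (agree_sum (index_iota 0 m)
  (fun i => agreeZ (c i * t ^+ i) (agree_power i))) => x.
by rewrite mulr_sumr; apply: eq_bigr => i _; rewrite exprMn; ring.
Qed.

Let agree_cos t : agree (fun x => W x * cos (t * th x)).
Proof.
apply: (@agree_dct (fun m x => W x * series (cos_coeff (t * th x)) m) _ _ _ _ (bound t)).
- move=> m; apply: agree_eq (agree_power_sum m (cos_coeff 1) t) => x.
  by rewrite series_cos_coeffE.
- move=> x; apply: cvgM; first exact: cvg_cst.
  exact: cvg_cos_series.
- move=> m x; rewrite normrM (ger0_norm (W0 x)) ler_wpM2l//.
  by apply: (le_trans (series_cos_coeff_le _ _)); exact: expR_norm_le.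
Qed.

Let agree_sin t : agree (fun x => W x * sin (t * th x)).
Proof.
apply: (@agree_dct (fun m x => W x * series (sin_coeff (t * th x)) m) _ _ _ _ (bound t)).
- move=> m; apply: agree_eq (agree_power_sum m (sin_coeff 1) t) => x.
  by rewrite series_sin_coeffE.
- move=> x; apply: cvgM; first exact: cvg_cst.
  exact: cvg_sin_series.
- move=> m x; rewrite normrM (ger0_norm (W0 x)) ler_wpM2l//.
  by apply: (le_trans (series_sin_coeff_le _ _)); exact: expR_norm_le.
Qed.

(** The extra cosine of free frequency [c] makes the induction close, through [2 cos u cos (c u) =
    cos ((c + 1) u) + cos ((c - 1) u)]. *)
Let agree_cosX n (s a c : R) : agree (fun x =>
  W x * (cos (s * (th x - a)) ^+ n * cos (c * (s * (th x - a))))).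
Proof.
elim: n c => [|n IH] c.
  apply: agree_eq (agreeD (agreeZ (cos (c * s * a)) (agree_cos (c * s)))
    (agreeZ (sin (c * s * a)) (agree_sin (c * s)))) => x.
  rewrite expr0 mul1r (_ : c * (s * (th x - a)) = c * s * th x - c * s * a); last by ring.
  by rewrite cosB; ring.
apply: agree_eq (agreeD (agreeZ 2^-1 (IH (c + 1))) (agreeZ 2^-1 (IH (c - 1)))) => x.
rewrite mulrDl mulrBl mul1r cosD cosB exprS.
set u := cos (s * _); set v := cos (c * _).
set w := sin (s * _); set z := sin (c * _).
by field; rewrite ?pnatr_eq0.
Qed.

Let agree_poly (p : {poly R}) (s a : R) : agree (fun x =>
  W x * p.[cos (s * (th x - a))]).
Proof.
apply: (agree_eq _ (agree_sum (index_iota 0 (size p)) (fun i => agreeZ p`_i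
  (agree_cosX i s a 0)))) => x.
rewrite horner_coef -(big_mkord xpredT (fun i => p`_i * cos (s * (th x - a)) ^+ i)).
rewrite mulr_sumr; apply: eq_bigr => i _.
by rewrite mul0r cos0; ring.
Qed.

Let agree_W : agree W.
Proof. by apply: agree_eq (tilt 0) => x; rewrite mul0r expR0 mulr1. Qed.

Let cos_bd (y : R) : -1 <= cos y <= 1. Proof. by rewrite cos_geN1 cos_le1. Qed.

Let agree_cos_step (s a c : R) : -1 <= c <= 1 ->
  agree (fun x => W x * (c < cos (s * (th x - a)))%R%:R).
Proof.
move=> c1.
apply: (@agree_dct (fun n x => W x * (step_poly c n).[cos (s * (th x - a))])
  _ _ _ _ agree_W).
- by move=> n; exact: agree_poly.
- by move=> x; apply: cvgM; [exact: cvg_cst|exact: cvg_step_poly].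
- by move=> n x; rewrite normrM (ger0_norm (W0 x)) ler_piMr// step_poly_le1.
Qed.

Let agree_interval (a r : R) : 0 < r ->
  agree (fun x => W x * (`|th x - a| < r)%R%:R).
Proof.
move=> r0.
apply: (@agree_dct (fun n x => W x *
  (cos (n.+1%:R^-1 * r) < cos (n.+1%:R^-1 * (th x - a)))%R%:R) _ _ _ _ agree_W).
- by move=> n; apply: agree_cos_step.
- move=> x; apply: cvgM; first exact: cvg_cst.
  (* Once [n + 1 >= b], both arguments divided by [n + 1] lie in [[0, 1]], inside the range where
     the cosine decreases, and comparing cosines is comparing arguments. *)
  pose b := Num.max `|th x - a| r.
  apply: (@cvg_near_cst _ _ _ _ _ _) => //.
  exists (Num.bound b) => // n /= bn.
  have n0 : (0 : R) < n.+1%:R^-1 by rewrite invr_gt0.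
  have b0 : 0 <= b by rewrite le_max normr_ge0.
  have nb : n.+1%:R^-1 * b <= pi.
    apply: (@le_trans _ _ 1); last first.
      by have := pihalf_ge1 R; lra.
    rewrite mulrC ler_pdivrMr// mul1r.
    apply: (le_trans (ltW (archi_boundP b0))).
    by rewrite ler_nat (leq_trans bn).
  rewrite -[cos (_ * (th x - a))]cos_norm normrM (gtr0_norm n0) ltr_cos.
  + by rewrite ltr_pM2l.
  + rewrite in_itv/=; apply/andP; split; first by rewrite mulr_ge0// ltW.
    by apply: le_trans nb; rewrite ler_pM2l// le_max lexx ?orbT.
  + rewrite in_itv/=; apply/andP; split; first by rewrite mulr_ge0// ltW.
    by apply: le_trans nb; rewrite ler_pM2l// le_max lexx ?orbT.
- move=> n x; rewrite normrM (ger0_norm (W0 x)) ler_piMr//.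
  by case: (_ < _); rewrite /= ?normr0 ?normr1.
Qed.

(** The intervals with left end [c] and centre [c + n + 1] increase to the half-line. *)
Lemma agree_half_space c : agree (fun x => W x * (c < th x)%R%:R).
Proof.
apply: (@agree_dct (fun n x => W x * (`|th x - (c + n.+1%:R)| < n.+1%:R)%R%:R)
  _ _ _ _ agree_W).
- by move=> n; apply: agree_interval.
- move=> x; apply: cvgM; first exact: cvg_cst.
  apply: (@cvg_near_cst _ _ _ _ _ _) => //.
  exists (Num.bound `|th x - c|) => // n /= bn.
  have h : `|th x - c| < n.+1%:R.
    apply: (lt_le_trans (archi_boundP (normr_ge0 _))).
    by rewrite ler_nat (leq_trans bn).
  congr (_%:R); congr (nat_of_bool _).
  move: h; rewrite !ltr_norml => /andP[h1 h2].
  apply/idP/idP; first by move=> /andP[]; lra.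
  by move=> ?; apply/andP; split; lra.
- move=> n x; rewrite normrM (ger0_norm (W0 x)) ler_piMr//.
  by case: (_ < _); rewrite /= ?normr0 ?normr1.
Qed.

End tilt.

End agreement.

(** * Uniqueness of Laplace transforms on a Hilbert space *)

Section laplace.
Context (R : realType) (H : completeNormedModType R) (ip : H -> H -> R).
Hypothesis hH : hilbert_space ip.

Local Notation T := (borel H).

Let hip : inner_product ip. Proof. by case: hH. Qed.

Lemma measurable_ip (x : H) : measurable_fun setT (ip x : T -> R).
Proof.
apply: continuous_borel => y.
apply/cvgrPdist_lt => e e0.
have c0 : 0 < `|x| + 1 by rewrite ltr_wpDl.
have ec : 0 < e / (`|x| + 1) by rewrite divr_gt0.
apply/nbhs_ballP; exists (e / (`|x| + 1)) => //= z.
rewrite -ball_normE /ball_/= ltr_pdivlMr// => hz.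
rewrite -(ipBr hip); apply: (le_lt_trans (ip_le_norm hip _ _)).
by apply: le_lt_trans hz; rewrite mulrC ler_wpM2l// lerDl.
Qed.

Definition half_spaces (s : seq (H * R)) (y : H) :=
  all (fun p => p.2 < ip p.1 y) s.

Definition half_space_sets : set (set T) :=
  [set A | exists s, A = [set y : T | half_spaces s y]].

Lemma measurable_half_spaces s : measurable [set y : T | half_spaces s y].
Proof.
elim: s => [|p s IH].
  by rewrite (_ : [set _ | _] = setT)//; apply/seteqP; split.
have -> : [set y : T | half_spaces (p :: s) y] =
    (ip p.1 : T -> R) @^-1` `]p.2, +oo[ `&` [set y : T | half_spaces s y].
  apply/seteqP; split => y /=; rewrite in_itv/= andbT.
    by move=> /andP[].
  by move=> [h1 h2]; apply/andP.
apply: measurableI => //; rewrite -[X in measurable X]setTI.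
exact: measurable_ip.
Qed.

Let G := half_space_sets.

Lemma setI_closed_half_spaces : setI_closed half_space_sets.
Proof.
move=> A B [s ->] [t ->]; exists (s ++ t); apply/seteqP; split => y /=;
  rewrite /half_spaces all_cat; first by move=> [-> ->].
by move=> /andP[].
Qed.

Let G1 (x : H) (c : R) : <<s G >> [set y : T | c < ip x y].
Proof.
apply: sub_sigma_algebra; exists [:: (x, c)]; apply/seteqP; split => y /=;
  by rewrite /half_spaces/= andbT.
Qed.

(** A closed ball is cut out by its supporting half-spaces, and a dense sequence of normals
    suffices: one that is close to [y - a] itself recovers the norm up to any error. *)
Lemma closed_ball_half_spaces (a : H) (r : R) : 0 <= r ->
  <<s G >> [set y : T | `|(y : H) - a| <= r].
Proof.
move=> r0; have [dn hd] := dense_seq hH.2.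
have -> : [set y : T | `|(y : H) - a| <= r] =
    \bigcap_n ~` [set y : T | r * `|dn n| + ip (dn n) a < ip (dn n) y].
  apply/seteqP; split => y /=.
    move=> ya n _ /=; apply/negP; rewrite -leNgt -lerBlDr -(ipBr hip).
    apply: (le_trans (ler_norm _)); apply: (le_trans (ip_le_norm hip _ _)).
    by rewrite mulrC ler_wpM2r.
  move=> h; set z := (y : H) - a.
  have key n : ip (dn n) z <= r * `|dn n|.
    have := h n Logic.I; move=> /= /negP; rewrite -leNgt.
    by rewrite -lerBlDr -(ipBr hip).
  have [z0|z0] := eqVneq z 0; first by rewrite z0 normr0.
  have nz : 0 < `|z| by rewrite normr_gt0.
  suff : `|z| ^+ 2 <= r * `|z| by rewrite expr2 ler_pM2r.
  apply/ler_addgt0Pr => e e0.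
  have c0 : 0 < `|z| + r by rewrite ltr_pwDl.
  have [n hn] := hd z (e / (`|z| + r)) (divr_gt0 e0 c0).
  have h1 : `|z| ^+ 2 <= ip (dn n) z + `|z - dn n| * `|z|.
    rewrite -(ipxx hip) -lerBlDl -(ipBl hip).
    exact: (le_trans (ler_norm _) (ip_le_norm hip _ _)).
  have h2 : r * `|dn n| <= r * `|z| + r * `|z - dn n|.
    rewrite -mulrDr ler_wpM2l//.
    have := ler_normD z (dn n - z); rewrite addrCA subrr addr0 (distrC (dn n)).
    by [].
  have h3 : `|z - dn n| * (`|z| + r) <= e.
    by rewrite -ler_pdivlMr// ltW.
  have := key n; nra.
apply: (@bigcap_measurable _ (g_sigma_algebraType G)) => // n _.
by apply: (@measurableC _ (g_sigma_algebraType G)); exact: G1.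
Qed.

(** By separability an open set is a countable union of closed balls with centres [dn i] and radii
    [1 / (m + 1)]. *)
Lemma half_spaces_generate (A : set T) : measurable A -> <<s half_space_sets >> A.
Proof.
move: A; apply: smallest_sub; first exact: smallest_sigma_algebra.
move=> A oA; have [dn hd] := dense_seq hH.2.
pose B i m := [set y : T | `|(y : H) - dn i| <= m.+1%:R^-1].
have -> : A = \bigcup_i \bigcup_m
    (if `[< B i m `<=` A >] then B i m else set0).
  apply/seteqP; split => x; last first.
    by move=> [i _ [m _]]; case: asboolP => // h; exact: h.
  move=> Ax; have /nbhs_ballP[e /= e0 he] : nbhs (x : H) A.
    exact: open_nbhs_nbhs.
  have e2 : 0 < e / 2 by rewrite divr_gt0.
  have [m hm] : exists m, m.+1%:R^-1 < e / 2.
    have /cvgrPdist_lt/(_ _ e2)[N _ /(_ N (leqnn N))] := @cvg_inv_nat R.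
    by rewrite /= sub0r normrN => /(le_lt_trans (ler_norm _)) ?; exists N.
  have [i hi] := hd x m.+1%:R^-1 ltac:(by rewrite invr_gt0).
  exists i => //; exists m => //.
  have BA : B i m `<=` A.
    move=> y hy; apply: he; rewrite -ball_normE /ball_/=.
    have := ler_normD ((x : H) - dn i) (dn i - (y : H)).
    rewrite addrA addrNK (distrC (dn i)); move: hy; rewrite /B/= => hy hxy.
    apply: (le_lt_trans hxy); rewrite (splitr e) ltrD//.
      exact: lt_trans hi hm.
    exact: le_lt_trans hy hm.
  by case: asboolP => // _; rewrite /B/= ltW.
apply: (@bigcup_measurable _ (g_sigma_algebraType G)) => i _.
apply: (@bigcup_measurable _ (g_sigma_algebraType G)) => m _.
case: asboolP => _; last exact: (@measurable0 _ (g_sigma_algebraType G)).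
exact: closed_ball_half_spaces.
Qed.

Variables (P Q : probability T R) (U : T -> R).
Hypothesis U0 : forall y, 0 < U y.
Hypothesis laplace : forall x : H, agree P Q (fun y : T => U y * expR (ip x y)).

(** Half-spaces are added one at a time, the earlier ones being part of the weight. The exponential
    factor is kept because tilting along the next normal only translates [x]. *)
Lemma agree_half_spaces s x : agree P Q
  (fun y : T => U y * expR (ip x y) * (half_spaces s y)%:R).
Proof.
elim: s x => [|p s IH] x.
  by apply: agree_eq (laplace x) => y; rewrite /half_spaces/= mulr1.
have h := @agree_half_space _ _ _ P Q
  (fun y => U y * expR (ip x y) * (half_spaces s y)%:R) (ip p.1) _ _ p.2.
apply: (agree_eq _ (h _ _)).
- move=> y; rewrite /half_spaces/= -mulnb natrM.
  by rewrite -mulrA; congr (_ * _); rewrite mulrC.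
- by move=> y; rewrite mulr_ge0// mulr_ge0 ?expR_ge0// ltW.
- move=> t; apply: agree_eq (IH (x + t *: p.1)) => y.
  by rewrite (ipDl hip) (ipZl hip) expRD; ring.
Qed.

(** The measures with density [U] have a common mass [m]. Normalised, they agree on finite
    intersections of half-spaces, a generating family stable under intersection, hence everywhere;
    dividing by the positive [U] recovers [P] and [Q]. *)
Lemma laplace_unique A : measurable A -> P A = Q A.
Proof.
have aU s : agree P Q (fun y : T => U y * (half_spaces s y)%:R).
  apply: agree_eq (agree_half_spaces s 0) => y.
  by rewrite (ip0l hip) expR0 mulr1.
have [iP iQ eU] : agree P Q U.
  by apply: agree_eq (aU [::]) => y; rewrite /half_spaces/= mulr1.
have mU := integrable_mfun iP.
pose m := \int[P]_y U y.
have m0 : 0 < m.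
  rewrite lt_neqAle Rintegral_ge0 ?andbT; last by move=> y _; exact: ltW.
  apply/negP => /eqP m0.
  have : (\int[P]_y `|(U y)%:E| = 0)%E.
    under eq_integral do rewrite /= ger0_norm ?ltW//.
    by rewrite -EFin_Rint// -/m -m0.
  move/(ae_eq_integral_abs _ measurableT (measurable_int P iP)).
  move=> [N [mN N0 sN]].
  have : N = setT.
    apply/seteqP; split => // y _; apply: sN => /= h.
    by have /eqP := h Logic.I; rewrite /= eqe gt_eqF.
  move=> NT; have : P N = 1%E by rewrite NT; exact: probability_setT.
  by rewrite N0 => /eqP; rewrite eqe eq_sym oner_eq0.
have U'0 y : 0 < U y / m by rewrite divr_gt0.
have mU' : measurable_fun setT (fun y => U y / m) by exact: measurable_funM.
have e1 (S : probability T R) : S.-integrable setT (EFin \o U) ->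
    \int[S]_y U y = m -> (\int[S]_y (U y / m)%:E = 1)%E.
  move=> iS eS; under eq_integral do rewrite mulrC.
  by rewrite -EFin_Rint ?RintegralZl ?eS ?mulVf ?gt_eqF//; exact: itgZ.
have [p1 hp1] := exists_density_prob mU' (fun y => ltW (U'0 y)) (e1 P iP erefl).
have [p2 hp2] := exists_density_prob mU' (fun y => ltW (U'0 y)) (e1 Q iQ (esym eU)).
have p12 : forall B, measurable B -> p1 B = p2 B.
  move=> B mB.
  apply: (@g_sigma_algebra_measure_unique _ _ _ half_space_sets _ (fun=> setT)) => //.
  - by move=> _ [s ->]; exact: measurable_half_spaces.
  - move=> _; exists [::]; by apply/seteqP; split.
  - by apply/seteqP; split => // y _; exists 0%N.
  - exact: setI_closed_half_spaces.
  - move=> _ [s ->]; have mS := measurable_half_spaces s.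
    have e (S p : probability T R) :
        (forall A, measurable A -> p A = (\int[S]_(y in A) (U y / m)%:E)%E) ->
        S.-integrable setT (EFin \o (fun y => U y * (half_spaces s y)%:R)) ->
        p [set y : T | half_spaces s y] =
        (m^-1 * \int[S]_y (U y * (half_spaces s y)%:R))%:E.
      move=> hp iS; rewrite hp// integral_mkcond -RintegralZl// EFin_Rint; last exact: itgZ.
      apply: eq_integral => y _; rewrite patchE.
      have [ys|ys] := boolP (half_spaces s y).
        by rewrite mem_set//= mulr1 mulrC.
      by rewrite memNset ?mulr0//=; exact/negP.
    have [i1 i2 e12] := aU s.
    transitivity (m^-1 * \int[P]_y (U y * (half_spaces s y)%:R))%:E.
      exact: (e P p1 hp1 i1).
    by rewrite e12; exact/esym/(e Q p2 hp2 i2).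
  - move=> _; apply: (@le_lt_trans _ _ (1 : R)%:E); last exact: ltry.
    by rewrite le_eqVlt; apply/orP; left; apply/eqP; exact: probability_setT.
  - exact: half_spaces_generate.
move=> mA.
have mUV : measurable_fun setT (fun y => (U y / m)^-1) by exact: measurable_pos_inv.
have mg : measurable_fun setT (fun y => \1_A y * (U y / m)^-1).
  by apply: measurable_funM => //; exact: measurable_indic.
have g0 y : 0 <= \1_A y * (U y / m)^-1.
  by rewrite mulr_ge0// invr_ge0 ltW.
have eA (S p : probability T R) :
    (forall A, measurable A -> p A = (\int[S]_(y in A) (U y / m)%:E)%E) ->
    S A = (\int[p]_y (\1_A y * (U y / m)^-1)%:E)%E.
  move=> hp; rewrite (ge0_integral_density mU' (fun y => ltW (U'0 y)) hp mg g0).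
  rewrite -[LHS](_ : \int[S]_y (\1_A y)%:E = _)%E; last first.
    by rewrite integral_indic// setIT.
  by apply: eq_integral => y _; rewrite -mulrA mulVf ?mulr1// gt_eqF.
rewrite (eA P p1 hp1) (eA Q p2 hp2).
by apply: eq_measure_integral => B mB _; exact: p12.
Qed.

End laplace.

(** * Second moments of Gaussian measures *)

Section gauss1_bounds.
Variable R : realType.
Implicit Types m s x : R.

(** The least value of the normal density within two standard deviations of its mean, times one
    standard deviation: a probability independent of [m] and [s]. *)
Definition gauss_tail : R := expR (-2) / Num.sqrt (2 * pi).

Lemma gauss_tail_gt0 : 0 < gauss_tail.
Proof. by rewrite divr_gt0 ?expR_gt0// sqrtr_gt0 mulr_gt0// pi_gt0. Qed.

Lemma gauss_tail_le1 : gauss_tail <= 1.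
Proof.
rewrite /gauss_tail ler_pdivrMr ?mul1r ?sqrtr_gt0 ?mulr_gt0 ?pi_gt0//.
apply: (@le_trans _ _ 1); first by rewrite expR_le1; lra.
by rewrite -[leLHS]sqrtr1 ler_wsqrtr//; have := pihalf_ge1 R; lra.
Qed.

Lemma normal_peakM s : 0 < s -> normal_peak s * s = (Num.sqrt (2 * pi))^-1.
Proof.
move=> s0; rewrite /normal_peak -mulrnAr sqrtrM ?sqr_ge0// sqrtr_sqr gtr0_norm//.
by rewrite invfM mulrAC mulVf ?mul1r ?gt_eqF// mulr_natl.
Qed.

Lemma normal_pdf_low m s x : 0 < s -> `|x - m| <= 2 * s ->
  normal_peak s * expR (-2) <= normal_pdf m s x.
Proof.
move=> s0 xm; rewrite normal_pdfE ?gt_eqF// ler_wpM2l ?normal_peak_ge0//.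
rewrite /normal_fun ler_expR mulNr lerN2 ler_pdivrMr; last first.
  by rewrite pmulrn_lgt0// exprn_gt0.
have h : `|x - m| ^+ 2 <= (2 * s) ^+ 2 by rewrite lerXn2r// nnegrE mulr_ge0// ltW.
by rewrite real_normK ?num_real// in h; rewrite -mulr_natr; lra.
Qed.

Lemma measurable_sqr_ge (a : R) : measurable [set x : R | a <= x ^+ 2].
Proof.
rewrite (_ : [set x : R | a <= x ^+ 2] = setT `&` (fun x : R => x ^+ 2) @^-1` `[a, +oo[).
  by apply: measurable_funX.
by rewrite setTI; apply/seteqP; split => x /=; rewrite in_itv/= andbT.
Qed.

Lemma normal_prob_tail m s : 0 < s ->
  (gauss_tail%:E <= normal_prob m s [set x | (m ^+ 2 + s ^+ 2 <= x ^+ 2)%R])%E.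
Proof.
move=> s0; have ss : 0 < 2 * s by rewrite mulr_gt0.
(* An interval of length [s] on the side of [m] away from 0, between one and two deviations from
   [m]; there [x^2 >= (|m| + s)^2]. *)
pose c := if 0 <= m then m + s else m - 2 * s.
have sub : `[c, c + s]%classic `<=` [set x | m ^+ 2 + s ^+ 2 <= x ^+ 2].
  move=> x /=; rewrite in_itv/= /c; case: (lerP 0 m) => m0 /andP[x1 x2]; nra.
have mI : measurable `[c, c + s]%classic by exact: measurable_itv.
have mp := measurable_normal_pdf m s.
have h1 : (\int[lebesgue_measure]_(x in `[c, (c + s)%R]) (normal_pdf m s x)%:E <=
    normal_prob m s [set x | (m ^+ 2 + s ^+ 2 <= x ^+ 2)%R])%E.
  apply: ge0_subset_integral => //.
  - exact: measurable_sqr_ge.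
  - by apply: measurable_funTS; exact/measurable_EFinP.
  - by move=> x _; rewrite lee_fin normal_pdf_ge0.
apply: le_trans h1.
apply: (@le_trans _ _ (\int[lebesgue_measure]_(x in `[c, (c + s)%R])
    (cst (normal_peak s * expR (-2))%:E) x)%E).
  rewrite integral_cst//= lebesgue_measure_itv/= lte_fin ltrDl s0.
  rewrite -EFinB -EFinM lee_fin addrAC subrr add0r mulrAC normal_peakM//.
  by rewrite /gauss_tail mulrC.
apply: ge0_le_integral => //=.
- by move=> x _; rewrite lee_fin mulr_ge0 ?normal_peak_ge0 ?expR_ge0.
- by apply: measurable_funTS; exact/measurable_EFinP.
- move=> x; rewrite in_itv/= lee_fin => /andP[x1 x2]; apply: normal_pdf_low => //.
  move: x1 x2; rewrite /c ler_norml; case: (lerP 0 m) => m0 x1 x2; apply/andP; split; lra.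
Qed.

Lemma normal_second_moment m s : 0 < s ->
  (\int[normal_prob m s]_x (x ^+ 2)%:E <= (16 * (m ^+ 2 + s ^+ 2))%:E)%E.
Proof.
move=> s0; have s20 : 0 < 2 * s by rewrite mulr_gt0.
have mp t := measurable_normal_pdf m t.
have mX : measurable_fun setT (fun x : R => x ^+ 2) by exact: measurable_funX.
have X0 (x : R) : 0 <= x ^+ 2 by exact: sqr_ge0.
rewrite (ge0_integral_density (mu := lebesgue_measure) (nu := normal_prob m s)
  (mp s) (normal_pdf_ge0 m s) (fun A _ => erefl) mX X0).
(* From [x^2 <= 2 m^2 + 2 (x - m)^2], the last square being absorbed by doubling the width; the
   integral of [g] is [2 m^2 + 16 s^2]. *)
pose g x := 2 * m ^+ 2 * normal_pdf m s x + 16 * s ^+ 2 * normal_pdf m (2 * s) x.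
have ig t : lebesgue_measure.-integrable [set: R] (EFin \o normal_pdf m t).
  exact: integrable_normal_pdf.
have eg t : \int[lebesgue_measure]_x normal_pdf m t x = 1.
  by rewrite /Rintegral integral_normal_pdf.
have igg : lebesgue_measure.-integrable [set: R] (EFin \o g).
  by apply: itgD; exact: itgZ.
apply: (@le_trans _ _ (\int[lebesgue_measure]_x (g x)%:E)%E); last first.
  rewrite -EFin_Rint// lee_fin /g RintegralD//; [|exact: itgZ..].
  rewrite !RintegralZl// !eg; have := sqr_ge0 m; lra.
have mf : measurable_fun setT (fun x : R => (x ^+ 2 * normal_pdf m s x)%:E).
  by apply/measurable_EFinP; apply: measurable_funM mX (mp s).
have mgE : measurable_fun setT (EFin \o g).
  by apply/measurable_EFinP; exact: integrable_mfun igg.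
have f0 (x : R) : setT x -> (0 <= (x ^+ 2 * normal_pdf m s x)%:E)%E.
  by rewrite lee_fin mulr_ge0 ?normal_pdf_ge0.
apply: ge0_le_integral => //.
move=> x _; rewrite lee_fin /g !normal_pdfE ?gt_eqF//.
have peak2 : normal_peak s = 2 * normal_peak (2 * s) :> R.
  apply: (mulIf (lt0r_neq0 s0)).
  by rewrite normal_peakM// -mulrA mulrCA normal_peakM.
rewrite peak2; have k0 : 0 <= normal_peak (2 * s) by exact: normal_peak_ge0.
set K := normal_peak (2 * s) in k0 *.
set e := normal_fun m s x; set e' := normal_fun m (2 * s) x.
(* [u e^(-u) <= 1] absorbs the square into a Gaussian of twice the width *)
have key : (x - m) ^+ 2 * e <= 4 * s ^+ 2 * e'.
  pose u := (x - m) ^+ 2 / (4 * s ^+ 2).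
  have s4 : 0 < 4 * s ^+ 2 by rewrite mulr_gt0// exprn_gt0.
  have u0 : 0 <= u by rewrite divr_ge0 ?sqr_ge0// ltW.
  have xmE : (x - m) ^+ 2 = 4 * s ^+ 2 * u by rewrite mulrC divfK// gt_eqF.
  have eE : e = expR (- u) * expR (- u).
    rewrite -expRD; congr expR; rewrite xmE -mulr_natr; field.
    by rewrite gt_eqF.
  have e'E : expR (- u) <= e'.
    rewrite /e' /normal_fun ler_expR xmE.
    have -> : - (4 * s ^+ 2 * u) / ((2 * s) ^+ 2 *+ 2) = - (u / 2).
      by field; rewrite gt_eqF.
    by rewrite lerN2 ler_pdivrMr//; lra.
  rewrite xmE eE -mulrA ler_pM2l// mulrA; apply: le_trans e'E.
  rewrite -[leRHS]mul1r ler_wpM2r ?expR_ge0//.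
  have h := expR_ge1Dx u.
  by rewrite expRN ler_pdivrMr ?expR_gt0// mul1r; lra.
have e0 : 0 <= e by exact: expR_ge0.
have h2 : x ^+ 2 <= 2 * m ^+ 2 + 2 * (x - m) ^+ 2.
  have := sqr_ge0 (x - 2 * m); nra.
have h3 : x ^+ 2 * e <= (2 * m ^+ 2 + 2 * (x - m) ^+ 2) * e by exact: ler_wpM2r.
have h4 : x ^+ 2 * e <= 2 * m ^+ 2 * e + 8 * s ^+ 2 * e' by lra.
have := ler_wpM2r (mulr_ge0 (ler0n R 2) k0) h4; lra.
Qed.

End gauss1_bounds.

(** * From one-dimensional projections to the norm *)

Section gaussian_moment.
Context (R : realType) (H : completeNormedModType R) (ip : H -> H -> R).
Hypothesis hH : hilbert_space ip.
Local Notation T := (borel H).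
Variable P : probability T R.
Hypothesis gP : gaussian_measure ip P.

Let hip : inner_product ip. Proof. by case: hH. Qed.

Let mip (h : H) : measurable_fun setT ((fun x : T => ip x h) : T -> R).
Proof.
under eq_fun do rewrite (ipC hip); exact: (measurable_ip hH h).
Qed.

(** The witness is [a = m^2 + s^2], the second moment of the projection. It is exceeded with a
    probability bounded below uniformly in [h], also in the degenerate case, where the projection is
    the constant [m]. *)
Lemma gaussian_projection (h : H) : exists a : R, [/\ 0 <= a,
  gauss_tail R <= \int[P]_x (a <= ip x h ^+ 2)%R%:R,
  P.-integrable setT (EFin \o (fun x : T => ip x h ^+ 2)) &
  \int[P]_x (ip x h ^+ 2) <= 16 * a].
Proof.
have [m [s [s0 hms]]] := gP h.
pose A := [set x : R | m ^+ 2 + s ^+ 2 <= x ^+ 2].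
have mX2 : measurable_fun setT (fun x : R => x ^+ 2) by exact: measurable_funX.
have X0 (x : R) : 0 <= x ^+ 2 by exact: sqr_ge0.
have mA : measurable A := measurable_sqr_ge (m ^+ 2 + s ^+ 2).
have mB : measurable ((fun x : T => ip x h) @^-1` A).
  by rewrite -[X in measurable X]setTI; exact: mip.
have bE : (fun x : T => (m ^+ 2 + s ^+ 2 <= ip x h ^+ 2)%R%:R : R) =
    \1_((fun x : T => ip x h) @^-1` A).
  apply/funext => x; rewrite indicE; congr (_%:R); congr nat_of_bool.
  by apply/idP/idP; rewrite inE.
have ib : P.-integrable setT (EFin \o (\1_((fun x : T => ip x h) @^-1` A) : T -> R)).
  exact: integrable_indic.
have eb : (\int[P]_x (\1_((fun x : T => ip x h) @^-1` A) x : R))%:E = gauss1 m s A.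
  by rewrite EFin_Rint// integral_indic// setIT; exact: hms.
have tail : ((gauss_tail R)%:E <= gauss1 m s A)%E.
  rewrite /gauss1; case: ifPn => [/eqP s00|sn0].
    rewrite diracE mem_set ?lee_fin ?gauss_tail_le1//=.
    by rewrite /A/= s00 expr0n/= addr0.
  by apply: normal_prob_tail; rewrite lt_neqAle eq_sym sn0.
have mom : (\int[P]_x (ip x h ^+ 2)%:E <= (16 * (m ^+ 2 + s ^+ 2))%:E)%E.
  move: hms; rewrite /gauss1; case: ifPn => [/eqP s00|sn0] hms.
    rewrite (ge0_integral_image (Q := \d_m) (mip h) hms mX2 X0).
    rewrite integral_dirac//; last exact/measurable_EFinP.
    rewrite diracE mem_set//= mul1e lee_fin s00 expr0n/= addr0.
    by have := sqr_ge0 m; lra.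
  have sgt0 : 0 < s by rewrite lt_neqAle eq_sym sn0.
  rewrite (ge0_integral_image (Q := normal_prob m s) (mip h) hms mX2 X0).
  exact: normal_second_moment.
have mip2 : measurable_fun setT (fun x : T => ip x h ^+ 2).
  by apply: measurable_funX; exact: mip.
have [i1 i2] := ge0_itg_fin mip2 (fun x => X0 _) mom.
exists (m ^+ 2 + s ^+ 2); split => //; first by rewrite addr_ge0.
by rewrite bE -lee_fin eb.
Qed.

Lemma exists_large_ball (dl : R) : 0 < dl -> exists n : nat,
  1 - dl <= \int[P]_x (`|x : H| ^+ 2 <= n%:R)%R%:R.
Proof.
move=> dl0.
have mn : measurable_fun setT ((fun x => `|x|) : T -> R).
  by apply: continuous_borel => x; exact: norm_continuous.
have [] := @Rint_dct _ _ _ P (fun n (x : T) => (`|x : H| ^+ 2 <= n%:R)%R%:R : R)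
  (cst 1) (cst 1).
- move=> n.
  have -> : (fun x : T => (`|x : H| ^+ 2 <= n%:R)%R%:R : R) =
      \1_((fun x : T => `|x : H| ^+ 2) @^-1` `]-oo, n%:R]).
    apply/funext => x; rewrite indicE; congr (_%:R); congr nat_of_bool.
    by apply/idP/idP; rewrite inE/= in_itv.
  apply: measurable_indic; rewrite -[X in measurable X]setTI.
  by apply: (measurable_funX 2 mn).
- move=> x; apply: (@cvg_near_cst _ _ _ _ _ _).
  exists (Num.bound (`|x : H| ^+ 2)) => // n /= bn.
  rewrite (le_trans (ltW (archi_boundP (sqr_ge0 _))))// ler_nat//.
- exact: finite_measure_integrable_cst.
- by move=> n x; rewrite normr_nat (ler_nat _ _ 1) leq_b1.
rewrite Rint_prob_cst => _ /cvgrPdist_lt/(_ _ dl0)[n _ /(_ n (leqnn n))] /=.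
move=> /(le_lt_trans (ler_norm _)) h; exists n.
by rewrite lerBlDl -lerBlDr ltW.
Qed.

(* Each coordinate exceeds its own scale [a e] with a universal probability, also
   inside a large enough ball, so the radius of that ball bounds [sum a e]. *)
Lemma gaussian_second_moment : has_second_moment P.
Proof.
have /choice[a ha] := gaussian_projection.
pose p := gauss_tail R; have p0 : 0 < p := gauss_tail_gt0 R.
have p2 : 0 < p / 2 by rewrite divr_gt0.
have [n hn] := exists_large_ball p2.
have mn : measurable_fun setT ((fun x => `|x|) : T -> R).
  by apply: continuous_borel => x; exact: norm_continuous.
pose b (x : T) : R := (`|x : H| ^+ 2 <= n%:R)%R%:R.
pose c (e : H) (x : T) : R := (a e <= ip x e ^+ 2)%R%:R.
have ib (f : T -> bool) : measurable_fun setT f ->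
    P.-integrable setT (EFin \o (fun x => (f x)%:R : R)).
  move=> mf; apply: (@itg_bounded _ _ _ _ _ 1).
    have -> : (fun x => (f x)%:R : R) = \1_(f @^-1` [set true]).
      apply/funext => x; rewrite indicE; congr (_%:R); congr nat_of_bool.
      by apply/idP/idP; rewrite inE/=.
    by apply: measurable_indic; rewrite -[X in measurable X]setTI; exact: mf.
  by move=> x; case: (f x); rewrite /= ?normr0 ?normr1.
have ipb : P.-integrable setT (EFin \o b).
  by apply: ib; apply: measurable_fun_ler => //; exact: measurable_funX.
have ipc e : P.-integrable setT (EFin \o c e).
  by apply: ib; apply: measurable_fun_ler => //; apply: measurable_funX; exact: mip.
have bc e : P.-integrable setT (EFin \o (fun x => b x * c e x)) /\
    p / 2 <= \int[P]_x (b x * c e x).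
  have bcE x : b x * c e x = (((`|x : H| ^+ 2 <= n%:R) && (a e <= ip x e ^+ 2))%R%:R : R).
    by rewrite /b /c -natrM mulnb.
  have i : P.-integrable setT (EFin \o (fun x => b x * c e x)).
    apply: (@itg_bounded _ _ _ _ _ 1).
      by apply: measurable_funM; [exact: integrable_mfun ipb|exact: integrable_mfun (ipc e)].
    by move=> x; rewrite bcE; case: (_ && _); rewrite /= ?normr0 ?normr1.
  split => //.
  have [_ h1 _ _] := ha e.
  have i1 : P.-integrable setT (EFin \o (fun x => b x + c e x - 1)).
    by apply: itgB; [exact: itgD|exact: finite_measure_integrable_cst].
  (* Union bound: the ball misses mass at most [p / 2], so the two events meet with probability at
     least [p / 2]. *)
  apply: (@le_trans _ _ (\int[P]_x (b x + c e x - 1))).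
    rewrite RintegralB//; [|exact: itgD|exact: finite_measure_integrable_cst].
    rewrite RintegralD// Rint_prob_cst; rewrite -/p in h1.
    have h1' : p <= \int[P]_x c e x by exact: h1.
    have hn' : 1 - p / 2 <= \int[P]_x b x by exact: hn.
    lra.
  apply: le_Rintegral => // x _; rewrite /b /c.
  by case: (_ <= n%:R); case: (a e <= _); rewrite /=; lra.
have sum_a E : orthonormal ip E -> \sum_(e <- E) a e <= 2 * n%:R / p.
  move=> oE; rewrite ler_pdivlMr//.
  suff : \sum_(e <- E) a e * (p / 2) <= n%:R by rewrite -mulr_suml; lra.
  (* Where [c e] is 1, [a e] is at most the squared coordinate along [e]; inside the ball Bessel's
     inequality bounds the sum of these by [n]. *)
  apply: (@le_trans _ _ (\int[P]_x \sum_(e <- E) (a e * (b x * c e x)))).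
    rewrite Rint_sum; last by move=> e; apply: itgZ; case: (bc e).
    apply: ler_sum => e _; have [i h] := bc e; rewrite RintegralZl//.
    by apply: ler_wpM2l => //; case: (ha e).
  rewrite -[leRHS](Rint_prob_cst P); apply: le_Rintegral => //.
  - by apply: itg_sum => e; apply: itgZ; case: (bc e).
  - exact: finite_measure_integrable_cst.
  move=> x _; rewrite /b; case: (lerP (`|x : H| ^+ 2) n%:R) => xn; last first.
    by rewrite big1// => e _; rewrite mul0r mulr0.
  apply: (le_trans _ xn); rewrite (norm_proj hip x oE).
  apply: (@le_trans _ _ (\sum_(e <- E) ip x e ^+ 2)); last by rewrite lerDl sqr_ge0.
  apply: ler_sum => e _; rewrite mul1r /c; case: (lerP (a e)) => h /=.
    by rewrite mulr1.
  by rewrite mulr0 sqr_ge0.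
have [dn hd] := dense_seq hH.2.
(* [E m] spans the first [m + 1] points of the dense sequence, so the truncated sums of squared
   coordinates tend to [|x|^2]; their integrals are bounded uniformly in [m] by [sum_a]. *)
have /choice[E hE] : forall n, exists E, orthonormal ip E /\
    forall x, x \in [seq dn i | i <- iota 0 n.+1] -> x = proj ip E x.
  by move=> m; exact: gram_schmidt.
have ie (e : H) : P.-integrable setT (EFin \o (fun x : T => ip x e ^+ 2)).
  by case: (ha e).
have [] := @Rint_fatou _ _ _ P (fun m (x : T) => \sum_(e <- E m) ip x e ^+ 2)
  (fun x : T => `|x : H| ^+ 2) (fun=> 16 * (2 * n%:R / p)) (16 * (2 * n%:R / p)).
- by move=> m; exact: integrable_mfun (itg_sum (E m) ie).
- by move=> m x; apply: sumr_ge0 => e _; exact: sqr_ge0.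
- move=> x; apply/cvgrPdist_lt => e e0.
  (* A distance below 1 dominates its square. *)
  have me : 0 < Num.min 1 e by rewrite lt_min ltr01.
  have [i hi] := hd x _ me; exists i => // m /= im.
  have [oE hEm] := hE m.
  rewrite (norm_proj hip x oE) addrAC subrr add0r ger0_norm ?sqr_ge0//.
  have dE : dn i = proj ip (E m) (dn i).
    by apply: hEm; apply: map_f; rewrite mem_iota add0n ltnS im.
  apply: (le_lt_trans (proj_min hip x oE dE)).
  move: hi; rewrite lt_min => /andP[h1 h2]; apply: le_lt_trans h2.
  by rewrite expr2 ler_piMr// ltW.
- by move=> m; exact: itg_sum.
- move=> m; have [oE _] := hE m; rewrite Rint_sum//.
  apply: (@le_trans _ _ (\sum_(e <- E m) 16 * a e)).
    by apply: ler_sum => e _; case: (ha e).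
  by rewrite -mulr_sumr ler_pM2l// sum_a.
- exact: cvg_cst.
by [].
Qed.

End gaussian_moment.

Section measure_invariance.
Context (R : realType) (H : completeNormedModType R).
Variable eps : R.

(* Probabilities that agree on measurable sets need not be equal functions. *)
Lemma eq_OTeps (P Q P' Q' : probability (borel H) R) :
  (forall A, measurable A -> P A = P' A) ->
  (forall A, measurable A -> Q A = Q' A) ->
  OTeps eps P Q = OTeps eps P' Q'.
Proof.
move=> PP' QQ'.
have prodE A : measurable A -> (P \x Q)%E A = (P' \x Q')%E A.
  move=> mA; apply: product_measure_unique => // B C mB mC.
  by rewrite /= PP'// QQ'//; exact: product_measure1E.
have KLE pi : KL pi (P \x Q)%E = KL pi (P' \x Q')%E.
  rewrite /KL; congr ereal_inf.
  have dE f : density_of pi (P \x Q)%E f <-> density_of pi (P' \x Q')%E f.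
    split=> -[mf f0 fE]; split => // A mA; rewrite fE//;
      apply: eq_measure_integral => B mB _; (exact: prodE || exact/esym/prodE).
  have iE (f : borel H * borel H -> R) : (\int[P \x Q]_x (f x * ln (f x))%:E =
      \int[P' \x Q']_x (f x * ln (f x))%:E)%E.
    by apply: eq_measure_integral => B mB _; exact: prodE.
  apply/seteqP; split => _ [f hf <-]; exists f.
  - exact/dE.
  - exact/esym/iE.
  - exact/dE.
  - exact/iE.
have cE (pi : probability (borel H * borel H)%type R) :
    coupling P Q pi <-> coupling P' Q' pi.
  split=> -[c1 c2]; split => A mA.
  - by rewrite c1// PP'.
  - by rewrite c2// QQ'.
  - by rewrite c1// PP'.
  - by rewrite c2// QQ'.
rewrite /OTeps; congr ereal_inf.
apply/seteqP; split => _ [pi hpi <-]; exists pi.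
- exact/cE.
- by congr (_ + eps%:E * _)%E; exact/esym/KLE.
- exact/cE.
- by congr (_ + eps%:E * _)%E; exact/KLE.
Qed.

End measure_invariance.

Theorem mainTheorem9 (R : realType) (H : completeNormedModType R)
    (ip : H -> H -> R) (hH : hilbert_space ip) (eps : R) (heps : 0 < eps)
    (mu0 mu1 : probability (borel H) R)
    (g0 : gaussian_measure ip mu0) (g1 : gaussian_measure ip mu1) :
  (0 <= Seps eps mu0 mu1)%E /\
  (Seps eps mu0 mu1 = 0%E <->
     forall A : set (borel H), measurable A -> mu0 A = mu1 A).
Proof.
have m0 := gaussian_second_moment hH g0.
have m1 := gaussian_second_moment hH g1.
have [h0 [s0 p0]] := gker_potential hH heps m0.
have [h1 [s1 p1]] := gker_potential hH heps m1.
have gk := good_gker hH heps.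
pose L0 := - \int[mu0]_x ln (h0 x); pose L1 := - \int[mu1]_x ln (h1 x).
have SE : Seps eps mu0 mu1 = (OTeps eps mu0 mu1 - (eps * (L0 + L1))%:E)%E.
  rewrite /Seps (OTeps_self hH heps m0 p0) (OTeps_self hH heps m1 p1).
  congr (_ - _)%E; rewrite -EFinD -EFinM; congr (_%:E).
  by rewrite -/L0 -/L1; field.
(* The pointwise form of the bound by the squared norm of [h0 - h1]; used at every [x], it is enough
   to identify the potentials. *)
have S_ge x : ((eps * ((h0 x - h1 x) ^+ 2 / 2))%:E <= Seps eps mu0 mu1)%E.
  have [i le] := potential_pair gk p0 p1 x.
  have := OTeps_ge hH heps m0 m1 p0 p1 i.
  rewrite SE leeBrDr// -EFinD; apply: le_trans; rewrite lee_fin -mulrDr.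
  by rewrite ler_pM2l// -/L0 -/L1; lra.
split.
  apply: le_trans (S_ge 0); rewrite lee_fin mulr_ge0 ?divr_ge0 ?sqr_ge0//.
  exact: ltW.
split=> [S0|e01]; last first.
  have e1 := eq_OTeps eps (fun A mA => erefl (mu0 A)) (fun A mA => esym (e01 A mA)).
  rewrite SE e1 (OTeps_self hH heps m0 p0).
  (* The two self-transport values coincide as well, which forces [L0 = L1]. *)
  have e2 := eq_OTeps eps e01 e01.
  rewrite (OTeps_self hH heps m0 p0) (OTeps_self hH heps m1 p1) in e2.
  rewrite -/L0; rewrite -/L0 -/L1 in e2; case: e2 => e2.
  by rewrite -EFinB; congr (_%:E); lra.
have h01 x : h0 x = h1 x.
  have := S_ge x; rewrite S0 lee_fin pmulr_rle0// => h.
  apply/eqP; rewrite -subr_eq0 -sqrf_eq0 eq_le sqr_ge0 andbT; lra.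
have [_ h0b h0E _ _] := p0; have [_ _ h1E _ _] := p1.
apply: (laplace_unique hH (U := fun y => gker eps 0 y / h0 y)).
  by move=> y; rewrite divr_gt0 ?gker_gt0//; case/andP: (h0b y).
(* With this scaling the cross term of [|x' - y|^2 / eps] is exactly [<x, y>], so [k(x', y)] is
   [k(0, y) exp <x, y>] up to the constant [exp (- |x'|^2 / eps)]. *)
move=> x; pose x' := (eps / 2) *: x.
have a : agree mu0 mu1 (fun y => gker eps x' y / h0 y).
  have [i0 e0] := h0E x'; have [i1 e1] := h1E x'.
  rewrite -(funext h01) in i1 e1; split => //.
  by rewrite e0 e1.
apply: agree_eq (agreeZ (expR (`|x'| ^+ 2 / eps)) a) => y.
rewrite mulrA [RHS]mulrAC /gker -!expRD; congr (expR _ / _).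
rewrite (normB2 hH.1) (normB2 hH.1) /x' (ipZl hH.1) (ip0l hH.1) normr0.
by field; rewrite gt_eqF.
Qed.
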